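(* Let $d\in\mathbb{N}$, $p$ a kernel and $\xi$ noise as in the context. Let $\nu\in\mathcal{I}$ satisfy $E^\nu|\eta(x)|<\infty$ for all $x\in\mathbb{Z}^d$, and suppose there exists $u\in\mathcal{H}_d$ such that \[\lim_{r\to\infty}r^{-1/2}\max_{x\in\mathbb{Z}^d:|x|\le r}E^\nu\bigl\{|\eta(x)-u(x)|\bigr\}=0.\] Then the same limit holds with $u(x)$ replaced by $\bar u(x)=E^\nu[\eta(x)]$, and there exists a probability measure $\gamma$ on $\mathbb{R}^d$ such that $\nu=\int_{\mathbb{R}^d}\pi_{\bar u+\alpha}\,\gamma(d\alpha)$.
   Context: The kernel $p:\mathbb{Z}^d\to[0,1)$ satisfies $\sum_x p(x)=1$, $p(x)=0$ for $|x|>M$ for some $M<\infty$, and strong aperiodicity: for every $u\in\mathbb{Z}^d$ the smallest additive subgroup of $\mathbb{Z}^d$ containing $\{u+x:p(x)>0\}$ is $\mathbb{Z}^d$; $p(x,y)=p(y-x)$, $p^k$ the $k$-step transition. $\xi=\{\xi_t(x)\}_{t\in\mathbb{Z},x\in\mathbb{Z}^d}$ are i.i.d. real, mean zero, finite variance. Configurations $\eta\in(\mathbb{R}^d)^{\mathbb{Z}^d}$ are written $\eta(x)=(\eta(x-e_i,x))_{i=1}^d\in\mathbb{R}^d$, with $|\cdot|$ the Euclidean norm. The increment Markov chain evolves by $\eta_{t+1}(x-e_i,x)=\sum_z p(0,z)\eta_t(x+z-e_i,x+z)+\xi_{t+1}(x)-\xi_{t+1}(x-e_i)$, $\xi_{t+1}$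 independent of $\eta_t$; $\mathcal{I}$ is the set of probability measures on $(\mathbb{R}^d)^{\mathbb{Z}^d}$ invariant for this chain. $\mathcal{H}_d$ is the set of $u=(u_1,\dots,u_d)$, $u_i:\mathbb{Z}^d\to\mathbb{R}$ with $\sum_y p(x,y)u_i(y)=u_i(x)$ for all $x$. $\Delta_0(x-e_i,x)=\sum_{k\ge 0}\sum_z\xi_{-k}(z)(p^k(x,z)-p^k(x-e_i,z))$. For a function $v:\mathbb{Z}^d\to\mathbb{R}^d$, $\pi_v$ denotes the law of the configuration $\{v_i(x)+\Delta_0(x-e_i,x)\}_{x\in\mathbb{Z}^d,i\le d}$; $\bar u+\alpha$ means $x\mapsto\bar u(x)+\alpha$. *)

(* Defs.v *)
From HB Require Import structures.
From mathcomp Require Import all_boot all_order all_algebra.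
From mathcomp Require Import all_classical all_reals all_analysis.
Set Implicit Arguments. Unset Strict Implicit. Unset Printing Implicit Defensive.
Import Order.TTheory GRing.Theory Num.Theory.
Import numFieldNormedType.Exports.
Local Open Scope classical_set_scope.
Local Open Scope ring_scope.

Definition Zd (d : nat) := 'rV[int]_d.
Definition e_ (d : nat) (i : 'I_d) : Zd d := delta_mx 0 i.
Definition znorm (R : realType) (d : nat) (x : Zd d) : R :=
  Num.sqrt (\sum_(i < d) ((x ord0 i)%:~R) ^+ 2).
Definition vnorm (R : realType) (d : nat) (v : 'I_d -> R) : R :=
  Num.sqrt (\sum_(i < d) (v i) ^+ 2).

Definition cyl_gen (I : Type) (R : realType) : set (set (I -> R)) :=
  fun A => exists (i : I) (B : set R), measurable B /\
           A = (fun f : I -> R => f i) @^-1` B.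
Definition prodR (I : Type) (R : realType) : measurableType (sigma_display (@cyl_gen I R)) :=
  g_sigma_algebraType (@cyl_gen I R).

(** Configurations eta in (R^d)^(Z^d); eta (x, i) stands for eta(x - e_i, x),
    the i-th component of eta(x). *)
Definition conf (R : realType) (d : nat) : measurableType _ := prodR (Zd d * 'I_d) R.

Definition is_addsubgroup (d : nat) (S : set (Zd d)) : Prop :=
  S 0 /\ (forall a b, S a -> S b -> S (a - b)).

(** strong aperiodicity: for every u, the smallest additive subgroup containing
    {u + x : p x > 0} is Z^d, i.e. every subgroup containing it is Z^d. *)
Definition strongly_aperiodic (R : realType) (d : nat) (p : Zd d -> R) : Prop :=
  forall (u : Zd d) (S : set (Zd d)), is_addsubgroup S ->
    (forall x, 0 < p x -> S (u + x)) -> S = setT.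

Definition is_kernel (R : realType) (d : nat) (p : Zd d -> R) : Prop :=
  [/\ (forall x, 0 <= p x /\ p x < 1),
      \sum_(x \in [set: Zd d]) p x = 1,
      (exists M : R, forall x, M < znorm R x -> p x = 0)
    & strongly_aperiodic p].

Fixpoint pk (R : realType) (d : nat) (p : Zd d -> R) (k : nat) (x y : Zd d) : R :=
  match k with
  | 0 => (x == y)%:R
  | k'.+1 => \sum_(z \in [set: Zd d]) p (z - x) * pk p k' z y
  end.

Definition iid_noise (R : realType) (d : nat) (dO : measure_display)
    (Omega : measurableType dO) (P : probability Omega R)
    (xi : int -> Zd d -> Omega -> R) : Prop :=
  [/\ (forall t x, measurable_fun setT (xi t x)),
      (forall (s : seq (int * Zd d)) (B : int * Zd d -> set R), uniq s ->
          (forall j, measurable (B j)) ->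
          P (\bigcap_(j in [set` s]) (xi j.1 j.2 @^-1` B j)) =
          (\prod_(j <- s) P (xi j.1 j.2 @^-1` B j))%E),
      (forall j j' (B : set R), measurable B ->
          P (xi j.1 j.2 @^-1` B) = P (xi j'.1 j'.2 @^-1` B)),
      (forall t x, P.-integrable setT (EFin \o xi t x) /\
                   (\int[P]_w (xi t x w)%:E = 0)%E)
    & (forall t x, (\int[P]_w ((xi t x w) ^+ 2)%:E < +oo)%E)].

(** One step of the increment chain, given the configuration eta and the
    fresh noise field zeta = xi_{t+1}. *)
Definition step (R : realType) (d : nat) (p : Zd d -> R) (eta : conf R d)
    (zeta : Zd d -> R) : conf R d :=
  fun xi_ => \sum_(z \in [set: Zd d]) p z * eta (xi_.1 + z, xi_.2)
             + zeta xi_.1 - zeta (xi_.1 - e_ xi_.2).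

(** nu is invariant: if eta ~ nu and xi_1 is independent of eta, then
    step eta xi_1 ~ nu (expressed through the transition kernel). *)
Definition chain_invariant (R : realType) (d : nat) (p : Zd d -> R)
    (dO : measure_display) (Omega : measurableType dO) (P : probability Omega R)
    (xi : int -> Zd d -> Omega -> R) (nu : probability (conf R d) R) : Prop :=
  forall A : set (conf R d), measurable A ->
    (\int[nu]_eta P ((fun w => step p eta (fun x => xi 1%R x w)) @^-1` A))%E = nu A.

Definition p_harmonic (R : realType) (d : nat) (p : Zd d -> R)
    (u : Zd d -> 'I_d -> R) : Prop :=
  forall x i, \sum_(y \in [set: Zd d]) p (y - x) * u y i = u x i.

Definition Delta0 (R : realType) (d : nat) (p : Zd d -> R)
    (dO : measure_display) (Omega : measurableType dO)
    (xi : int -> Zd d -> Omega -> R) (xi_ : Zd d * 'I_d) (w : Omega) : R :=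
  limn (fun n : nat => \sum_(0 <= k < n) (\sum_(z \in [set: Zd d])
     xi (- (k%:Z)) z w * (pk p k xi_.1 z - pk p k (xi_.1 - e_ xi_.2) z))).

Definition pi_ (R : realType) (d : nat) (p : Zd d -> R)
    (dO : measure_display) (Omega : measurableType dO) (P : probability Omega R)
    (xi : int -> Zd d -> Omega -> R) (v : Zd d * 'I_d -> R)
    (A : set (conf R d)) : \bar R :=
  P ((fun w => (fun xi_ => v xi_ + Delta0 p xi xi_ w) : conf R d) @^-1` A).

Definition ubar (R : realType) (d : nat) (nu : probability (conf R d) R)
    (x : Zd d) (i : 'I_d) : R :=
  fine (\int[nu]_eta (eta (x, i))%:E)%E.

Definition sublinear_dev (R : realType) (d : nat) (nu : probability (conf R d) R)
    (u : Zd d -> 'I_d -> R) : Prop :=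
  (fun r : R => ((Num.sqrt r)^-1)%:E *
     ereal_sup [set (\int[nu]_eta (vnorm (fun i => eta (x, i) - u x i))%:E)%E
               | x in [set x : Zd d | (znorm R x <= r)%R]])%E
    @ +oo --> 0%E.

(* Main.v *)
(** The step-[t] configuration of the chain is [A^t eta_0] plus the noise sum
    [Delta^(t)], where [A] averages over the kernel.  The noise sum converges to
    [Delta_0] almost surely: the random walk energy
    [E (A^k xi)(0)^2 - E (A^(k+1) xi)(0)^2] dominates the variance of
    [A^k xi(a) - A^k xi(b)] for [a, b] in the support of [p], so these variances
    are summable; the displacements for which they are summable form a subgroup,
    which by strong aperiodicity is everything, and Kolmogorov's maximal
    inequality applies.  In the same way the discrete gradient of
    [A^t (eta_0 - ubar)] tends to 0 in L1: the gradient of [p^t] has total mass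
    [O(t^-1/2)], while [E |eta_0 - ubar| = o(t^1/2)] on the range of [t] steps of the
    walk.  Using invariance once more, [A^t (eta_0 - ubar)(0)] is Cauchy in L1,
    because applied to [A^t' eta_0 + Delta^(t')] it only sees the tail of the noise
    series.  Its limit [alpha] depends on [eta_0] alone, hence is independent of the
    noise, and passing to the limit in [eta ~ A^t eta_0 + Delta^(t)] exhibits [nu]
    as the law of [ubar + alpha + Delta_0]; [gamma] is the law of [alpha]. *)

Require Import Defs.
From HB Require Import structures.
From mathcomp Require Import all_boot all_order all_algebra.
From mathcomp Require Import finmap.
From mathcomp Require Import all_classical all_reals all_analysis.
From mathcomp Require Import measurable_realfun ring lra.
Set Implicit Arguments. Unset Strict Implicit. Unset Printing Implicit Defensive.
Import Order.TTheory GRing.Theory Num.Theory.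
Import numFieldNormedType.Exports.
Local Open Scope classical_set_scope.
Local Open Scope ring_scope.

(** * Product spaces and i.i.d. fields *)

(** Independence enters only as resampling: in an i.i.d. field, replacing any set of coordinates by
    those of an independent copy preserves the law, and Tonelli then integrates the fresh
    coordinates alone. No conditional expectation occurs. To have one probability space for all
    times, the noise is indexed by age: layer $k$ is the noise $k$ steps old. The noise in $\eta_t$
    is then the $t$-th partial sum of one fixed series, and the initial configuration sits in the
    other factor of a product measure. The obstacle is that decay of gradients makes $A^{s+t}$ and
    $A^t$ close only for fixed $s$ and large $t$, which is not a Cauchy property. Replacing $\eta_0$
    by $\eta_t$ repairs this, because $t$ may be chosen after both indices $s$ and $s'$ that are to
    be compared. No local limit theorem is used: iterated averages are written as finite sums over
    weighted paths, and the bound on the gradient of $p^t$ is a variance computation on these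
    paths. *)

Section product_space.
Variables (I : Type) (R : realType).

Lemma measurable_coord (i : I) :
  measurable_fun [set: prodR I R] (fun f : prodR I R => f i).
Proof.
move=> _ B mB; rewrite setTI; apply: sub_sigma_algebra; by exists i, B.
Qed.

Lemma measurable_fun_prodR d (T : measurableType d) (Y : T -> prodR I R) :
  (forall i, measurable_fun [set: T] (fun t => Y t i)) ->
  measurable_fun [set: T] Y.
Proof.
move=> mY; apply: (measurability (rT := prodR I R) (@cyl_gen I R : set (set (prodR I R)))) => //.
move=> _ [_ [i [B [mB ->]]] <-]; exact: mY.
Qed.

(** A list of constraints, possibly repeating a coordinate, makes intersection a concatenation, so
    this is a $\pi$-system. Closed boxes are chosen because each is the zero set of a Lipschitz
    function of finitely many coordinates. *)
Definition upper_boxes : set (set (I -> R)) :=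
  [set A | exists s : seq (I * R),
     A = [set f | all (fun q => q.2 <= f q.1) s] ].

Lemma upper_boxesI : setI_closed upper_boxes.
Proof.
move=> _ _ [s ->] [s' ->]; exists (s ++ s'); apply/seteqP; split => f /=.
  by rewrite all_cat => -[-> ->].
by rewrite all_cat => /andP[].
Qed.

Lemma upper_boxesT : upper_boxes setT.
Proof. by exists [::]; apply/seteqP; split. Qed.

Lemma upper_boxes_measurable : upper_boxes `<=` @measurable _ (prodR I R).
Proof.
move=> _ [s ->]; elim: s => [|q s ihs].
  by rewrite [X in measurable X](_ : _ = setT)//; apply/seteqP; split.
rewrite [X in measurable X](_ : _ =
   ((fun f : prodR I R => f q.1) @^-1` `[q.2, +oo[%classic) `&`
   [set f | all (fun q => q.2 <= f q.1) s]).
  apply: measurableI => //; rewrite -[X in measurable X]setTI.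
  exact: measurable_coord.
apply/seteqP; split => f /=; rewrite in_itv/= andbT; first by move/andP.
by case=> -> ->.
Qed.

Lemma sigma_upper_boxes : @measurable _ (prodR I R) `<=` <<s upper_boxes >>.
Proof.
apply: smallest_sub; first exact: smallest_sigma_algebra.
move=> _ [i [B [mB ->]]].
have mi : measurable_fun setT (fun f : g_sigma_algebraType upper_boxes => f i).
  apply: (measurability (@measurable_realfun.RGenCInfty.G R)).
    exact: measurable_realfun.RGenCInfty.measurableE.
  move=> _ [_ [x ->] <-]; apply: sub_sigma_algebra.
  exists [:: (i, x)]; apply/seteqP; split => f /=; rewrite ?in_itv/= ?andbT.
    by case.
  by move=> ?; split.
rewrite -[X in <<s _ >> X]setTI; exact: mi.
Qed.

Lemma prodR_measure_unique (m1 m2 : probability (prodR I R) R) :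
  (forall s : seq (I * R),
     m1 [set f | all (fun q => q.2 <= f q.1) s] =
     m2 [set f | all (fun q => q.2 <= f q.1) s]) ->
  forall A, measurable A -> m1 A = m2 A.
Proof.
move=> m12 A mA.
apply: (@g_sigma_algebra_measure_unique _ R (prodR I R) upper_boxes
  upper_boxes_measurable (fun=> setT) _ _ m1 m2).
- by move=> _; exact: upper_boxesT.
- by apply/seteqP; split => // x _; exists 0%N.
- exact: upper_boxesI.
- by move=> _ [s ->]; exact: m12.
- by move=> _; rewrite (le_lt_trans (probability_le1 _ _))// ltry.
- exact: sigma_upper_boxes.
Qed.

End product_space.

Section law.
Context d d' (T : measurableType d) (U : measurableType d') (R : realType).
Variables (mu : probability T R) (Y : T -> U).
Hypothesis mY : measurable_fun [set: T] Y.

Let Y_mixin := isMeasurableFun.Build _ _ _ _ _ mY.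
Let Y_pack : {mfun T >-> U} := HB.pack Y Y_mixin.

Definition law : probability U R := distribution mu Y_pack.

Lemma ge0_integral_law (f : U -> \bar R) : measurable_fun [set: U] f ->
  (forall y, 0 <= f y)%E -> (\int[law]_y f y = \int[mu]_x f (Y x))%E.
Proof. by move=> mf f0; rewrite ge0_integral_distribution. Qed.

Lemma integral_law (f : U -> \bar R) : measurable_fun [set: U] f ->
  mu.-integrable setT (f \o Y) -> (\int[law]_y f y = \int[mu]_x f (Y x))%E.
Proof. by move=> mf f0; rewrite integral_distribution. Qed.

Lemma integrable_law (f : U -> \bar R) : measurable_fun [set: U] f ->
  mu.-integrable setT (f \o Y) -> law.-integrable setT f.
Proof. by move=> mf f0; apply: integrable_pushforward. Qed.

End law.

Section iid_fields.
Variables (J : choiceType) (R : realType) (m : set R -> \bar R).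

(** The marginal [m] is a bare set function, so that fields on different probability spaces can be
    said to share it, and hence their law. *)
Definition iid_field d (T : measurableType d) (mu : probability T R)
    (Y : T -> prodR J R) : Prop :=
  measurable_fun [set: T] Y /\
  forall (s : seq J) (B : J -> set R), uniq s -> (forall j, measurable (B j)) ->
    mu (\bigcap_(j in [set` s]) ((fun t => Y t j) @^-1` B j)) =
    (\prod_(j <- s) m (B j))%E.

Lemma iid_field_eq_law d (T : measurableType d) (mu : probability T R)
    (Y : T -> prodR J R) d' (T' : measurableType d') (mu' : probability T' R)
    (Y' : T' -> prodR J R) : iid_field mu Y -> iid_field mu' Y' ->
  forall A, measurable A -> mu (Y @^-1` A) = mu' (Y' @^-1` A).
Proof.
move=> [mY Yi] [mY' Yi'] A mA.
apply: (@prodR_measure_unique _ _ (law mu mY) (law mu' mY') _ A mA) => s.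
set S := [set f | _]; rewrite -[LHS]/(mu (Y @^-1` S)) -[RHS]/(mu' (Y' @^-1` S)).
(* A box may constrain one coordinate several times; [B j] merges all bounds on [j], so that the
   product formula applies to the duplicate-free list. *)
pose B (j : J) : set R := [set r | all (fun q => (q.1 == j) ==> (q.2 <= r)) s].
have mB j : measurable (B j).
  rewrite /B; elim: s {S B} => [|q s ihs].
    by rewrite [X in measurable X](_ : _ = setT)//; apply/seteqP; split.
  rewrite [X in measurable X](_ : _ =
     [set r | (q.1 == j) ==> (q.2 <= r)] `&`
     [set r | all (fun q => (q.1 == j) ==> (q.2 <= r)) s]).
    apply: measurableI => //; case: (q.1 == j) => /=.
      rewrite [X in measurable X](_ : _ = `[q.2, +oo[%classic)//.
      by apply/seteqP; split => r /=; rewrite in_itv/= andbT.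
    by rewrite [X in measurable X](_ : _ = setT)//; apply/seteqP; split.
  by apply/seteqP; split => r /=; [move/andP|case=> -> ->].
have E d0 (T0 : measurableType d0) (Y0 : T0 -> prodR J R) :
    Y0 @^-1` [set f | all (fun q => q.2 <= f q.1) s] =
    \bigcap_(j in [set` undup (map fst s)]) ((fun t => Y0 t j) @^-1` B j).
  apply/seteqP; split => t /=.
    move=> /allP H j _; apply/allP => q qs /=; apply/implyP => /eqP <-; exact: H.
  move=> H; apply/allP => q qs.
  have /H : q.1 \in undup (map fst s) by rewrite mem_undup map_f.
  by move=> /allP/(_ _ qs); rewrite eqxx.
by rewrite /S !E Yi ?undup_uniq// Yi' ?undup_uniq.
Qed.

(** The resampling principle: coordinates outside [b] are redrawn from an independent copy. Every
    later use of independence goes through this lemma. *)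
Lemma iid_field_mix d (T : measurableType d) (mu : probability T R)
    (Y : T -> prodR J R) d' (T' : measurableType d') (mu' : probability T' R)
    (Y' : T' -> prodR J R) (b : pred J) : iid_field mu Y -> iid_field mu' Y' ->
  iid_field (mu \x mu')%E
    (fun t j => if b j then Y t.1 j else Y' t.2 j).
Proof.
move=> [mY Yi] [mY' Yi']; split.
  apply: measurable_fun_prodR => j; case: (b j).
    apply: (measurableT_comp (f := fun t => Y t j)) => //.
    exact: (measurableT_comp (measurable_coord _)).
  apply: (measurableT_comp (f := fun t => Y' t j)) => //.
  exact: (measurableT_comp (measurable_coord _)).
move=> s B us mB.
pose E1 := \bigcap_(j in [set` seq.filter b s]) ((fun t => Y t j) @^-1` B j).
pose E2 := \bigcap_(j in [set` seq.filter (predC b) s]) ((fun t => Y' t j) @^-1` B j).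
have mE d0 (T0 : measurableType d0) (Y0 : T0 -> prodR J R) (s0 : seq J) :
    measurable_fun setT Y0 ->
    measurable (\bigcap_(j in [set` s0]) ((fun t => Y0 t j) @^-1` B j)).
  move=> mY0; apply: fin_bigcap_measurable; first exact: finite_seq.
  move=> j _; rewrite -[X in measurable X]setTI.
  exact: (measurableT_comp (measurable_coord _)).
rewrite [X in _ X = _](_ : _ = E1 `*` E2).
  transitivity (mu E1 * mu' E2)%E.
    by apply: product_measure1E; exact: mE.
  rewrite /E1 /E2 Yi ?filter_uniq// Yi' ?filter_uniq//.
  by rewrite [RHS](bigID b)/= !big_filter.
apply/seteqP; split => -[t t'] /=.
  move=> H; split=> j /=; rewrite mem_filter => /andP[bj js].
    by have := H j js; rewrite /= bj.
  by have := H j js; rewrite /= (negbTE bj).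
move=> [H1 H2] j /= js; case: ifPn => bj.
  by apply: H1; rewrite /= mem_filter bj.
by apply: H2; rewrite /= mem_filter /= bj.
Qed.

End iid_fields.

Lemma iid_field_reindex (J K : choiceType) (R : realType) (m : set R -> \bar R)
    (phi : K -> J) d (T : measurableType d) (mu : probability T R)
    (Y : T -> prodR J R) : injective phi -> iid_field m mu Y ->
  iid_field m mu (fun t => (fun k => Y t (phi k)) : prodR K R).
Proof.
move=> iphi [mY Yi]; split.
  by apply: measurable_fun_prodR => k; exact: (measurableT_comp (measurable_coord _)).
move=> s B us mB.
(* Events on [K] are transported to [J]; the intersection is all of [R] at indices not hit by [phi]
   on [s], and injectivity leaves a single set at the others. *)
pose B' (j : J) : set R := \bigcap_(k in [set k | k \in s /\ phi k = j]) B k.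
have B'E k : k \in s -> B' (phi k) = B k.
  move=> ks; apply/seteqP; split => [r|r Br k' /= [k's /iphi ->]//]; exact.
have := Yi (map phi s) B'; rewrite (map_inj_uniq iphi) => /(_ us).
have mB' j : measurable (B' j).
  apply: fin_bigcap_measurable => //.
  by apply: (sub_finite_set _ (finite_seq s)) => k [].
move=> /(_ mB'); rewrite big_map => H.
transitivity (\prod_(k <- s) m (B' (phi k)))%E; last first.
  by rewrite big_seq [RHS]big_seq; apply: eq_bigr => k ks; rewrite B'E.
rewrite -H; congr (mu _); apply/seteqP; split => t /= K0.
  by move=> j /= /mapP[k ks ->]; rewrite B'E//; exact: K0.
move=> k /= ks; have := K0 (phi k); rewrite /= map_f//.
by move=> /(_ isT); rewrite B'E.
Qed.

(** * The random walk *)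

Section walk.
Variables (R : realType) (d : nat) (p : Zd d -> R).

Definition supp : seq (Zd d) := enum_fset (fset_set [set x | p x != 0]).

Definition avg (f : Zd d -> R) (x : Zd d) : R :=
  \sum_(y <- supp) p y * f (x + y).

(** Each entry is an $n$-step path recorded as its probability, its displacement and the sum of [h]
    over its steps. Where the third component is irrelevant, [h] is taken to be 0. *)
Fixpoint paths (h : Zd d -> R) (n : nat) : seq (R * Zd d * R) :=
  if n is n'.+1 then
    [seq (p y * q.1.1, y + q.1.2, h y + q.2) | y <- supp, q <- paths h n']
  else [:: (1, 0, 0)].

Lemma iter_avgE h n f x :
  iter n avg f x = \sum_(q <- paths h n) q.1.1 * f (x + q.1.2).
Proof.
elim: n x => [|n ihn] x /=; first by rewrite big_seq1/= mul1r addr0.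
rewrite big_allpairs_dep /avg; apply: eq_bigr => y _.
rewrite -/avg ihn mulr_sumr; apply: eq_bigr => q _ /=.
by rewrite mulrA addrA.
Qed.

Lemma iter_avgD n f g x :
  iter n avg (fun z => f z + g z) x = iter n avg f x + iter n avg g x.
Proof.
rewrite !(iter_avgE (fun=> 0)) -big_split; apply: eq_bigr => q _.
by rewrite mulrDr.
Qed.

Lemma iter_avgB n f g x :
  iter n avg (fun z => f z - g z) x = iter n avg f x - iter n avg g x.
Proof.
rewrite !(iter_avgE (fun=> 0)) -sumrB; apply: eq_bigr => q _.
by rewrite mulrBr.
Qed.

Lemma iter_avg_sum n (I : Type) (r : seq I) (f : I -> Zd d -> R) x :
  iter n avg (fun z => \sum_(i <- r) f i z) x = \sum_(i <- r) iter n avg (f i) x.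
Proof.
under [RHS]eq_bigr do rewrite (iter_avgE (fun=> 0)).
rewrite (iter_avgE (fun=> 0)) exchange_big; apply: eq_bigr => q _.
by rewrite mulr_sumr.
Qed.

Lemma iter_avg_shift n f a x :
  iter n avg (fun z => f (z + a)) x = iter n avg f (x + a).
Proof.
rewrite !(iter_avgE (fun=> 0)); apply: eq_bigr => q _.
by rewrite addrAC.
Qed.

Lemma eq_iter_avg n f g x : f =1 g -> iter n avg f x = iter n avg g x.
Proof. by move=> /funext ->. Qed.

Hypothesis p_sum1 : \sum_(x \in [set: Zd d]) p x = 1.

(** A sum over an infinite support takes the default value 0, which contradicts the value 1. *)
Lemma finite_supp : finite_set [set x | p x != 0].
Proof.
apply: contrapT => fp; have := p_sum1; rewrite fsbig_dflt; last first.
  move=> fF; apply: fp; apply: sub_finite_set fF => x /= px.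
  by split=> //; apply/eqP.
by move=> /eqP; rewrite eq_sym oner_eq0.
Qed.

Lemma mem_supp x : (x \in supp) = (p x != 0).
Proof.
rewrite /supp in_fset_set; last exact: finite_supp.
by apply/idP/idP; rewrite inE.
Qed.

Lemma fsbig_uniq_seq (u : seq (Zd d)) (F : Zd d -> R) : uniq u ->
  (forall z, z \notin u -> F z = 0) ->
  \sum_(z \in [set: Zd d]) F z = \sum_(z <- u) F z.
Proof.
move=> uu F0; rewrite [RHS]fsbig_seq//; apply/esym/fsbig_widen => //.
by move=> z [_ /negP /F0].
Qed.

Lemma fsum_kernel (F : Zd d -> R) :
  \sum_(z \in [set: Zd d]) p z * F z = \sum_(z <- supp) p z * F z.
Proof.
apply: fsbig_uniq_seq; first exact: fset_uniq.
by move=> z; rewrite mem_supp negbK => /eqP ->; rewrite mul0r.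
Qed.

Lemma sum_supp : \sum_(z <- supp) p z = 1.
Proof.
rewrite -p_sum1; apply/esym/fsbig_uniq_seq; first exact: fset_uniq.
by move=> z; rewrite mem_supp negbK => /eqP.
Qed.

Lemma iter_avg_cst n c x : iter n avg (fun=> c) x = c.
Proof.
elim: n x => [//|n ihn] x /=; rewrite /avg.
by under eq_bigr do rewrite ihn; rewrite -mulr_suml sum_supp mul1r.
Qed.

Lemma fsum_shift x (F : Zd d -> R) :
  \sum_(z \in [set: Zd d]) p (z - x) * F z = avg F x.
Proof.
rewrite (@fsbig_uniq_seq [seq x + y | y <- supp]).
- by rewrite big_map; apply: eq_bigr => y _; rewrite addrAC subrr add0r.
- by rewrite map_inj_uniq ?fset_uniq//; exact: addrI.
- move=> z zn; suff -> : p (z - x) = 0 by rewrite mul0r.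
  apply/eqP; rewrite -[_ == _]negbK -mem_supp; apply: contra zn => zx.
  by apply/mapP; exists (z - x) => //; rewrite addrC subrK.
Qed.

Lemma pkE k x y : pk p k x y = iter k avg (fun z => (z == y)%:R) x.
Proof.
elim: k x => [//|k ihk] x /=; rewrite fsum_shift.
by congr avg; apply/funext => z; rewrite ihk.
Qed.

(** Turns the terms of [Delta0] into gradients of averaged noise. The function [f] is arbitrary,
    since $p^k$ only charges the endpoints of the finitely many paths collected in [u]. *)
Lemma fsum_pkB k (f : Zd d -> R) x x' :
  \sum_(z \in [set: Zd d]) f z * (pk p k x z - pk p k x' z) =
  iter k avg f x - iter k avg f x'.
Proof.
pose h : Zd d -> R := fun=> 0.
pose P := paths h k.
pose u := undup ([seq x + q.1.2 | q <- P] ++ [seq x' + q.1.2 | q <- P]).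
have pk0 z y : z \notin [seq y + q.1.2 | q <- P] -> pk p k y z = 0.
  move=> zn; rewrite pkE (iter_avgE h) big_seq big1// => q qP.
  case: eqP => [yz|]; last by rewrite mulr0.
  by move/mapP: zn; case; exists q.
rewrite (@fsbig_uniq_seq u) ?undup_uniq//; last first.
  move=> z; rewrite mem_undup mem_cat negb_or => /andP[z1 z2].
  by rewrite !pk0// subrr mulr0.
have E y : {subset [seq y + q.1.2 | q <- P] <= u} ->
    \sum_(z <- u) f z * pk p k y z = iter k avg f y.
  move=> sub; under eq_bigr do rewrite pkE (iter_avgE h) mulr_sumr.
  rewrite exchange_big (iter_avgE h) big_seq [RHS]big_seq.
  apply: eq_bigr => q qP; rewrite (bigD1_seq (y + q.1.2)) ?undup_uniq//=; last first.
    by apply: sub; apply/mapP; exists q.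
  rewrite eqxx mulr1 mulrC big1 ?addr0// => z /negbTE.
  by rewrite eq_sym => ->; rewrite mulr0 mulr0.
under eq_bigr do rewrite mulrBr.
by rewrite sumrB !E// => z zy; rewrite mem_undup mem_cat zy ?orbT.
Qed.

End walk.

(** * Gradient of the walk through weighted paths *)

Section walk_gradient.
Variables (R : realType) (d : nat) (p : Zd d -> R).
Hypothesis p_ge0 : forall x, 0 <= p x.
Hypothesis p_sum1 : \sum_(x \in [set: Zd d]) p x = 1.
Local Notation supp := (supp p).
Local Notation paths := (paths p).

Lemma path_weight_ge0 h n q : q \in paths h n -> 0 <= q.1.1.
Proof.
elim: n q => [|n ihn] q /=; first by rewrite inE => /eqP ->.
by move=> /allpairsP[[y q'] [_ q'P ->]] /=; rewrite mulr_ge0// ihn.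
Qed.

Lemma sum_path_weight h n : \sum_(q <- paths h n) q.1.1 = 1.
Proof.
rewrite -(iter_avg_cst p_sum1 n 1 0) (iter_avgE _ h).
by apply: eq_bigr => q _; rewrite mulr1.
Qed.

(** Stands in for [znorm]: an upper bound on displacements is all that is required, and
    subadditivity is immediate here. *)
Definition l1norm (x : Zd d) : R := \sum_(i < d) `|(x ord0 i)%:~R|.

Lemma l1norm_ge0 x : 0 <= l1norm x.
Proof. by apply: sumr_ge0 => i _. Qed.

Lemma l1norm0 : l1norm 0 = 0.
Proof. by apply: big1 => i _; rewrite mxE normr0. Qed.

Lemma l1normD x y : l1norm (x + y) <= l1norm x + l1norm y.
Proof.
rewrite -big_split ler_sum// => i _.
by rewrite mxE intrD ler_normD.
Qed.

Lemma znorm_le_l1norm x : znorm R x <= l1norm x.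
Proof.
rewrite -[leRHS]ger0_norm ?l1norm_ge0// -sqrtr_sqr ler_sqrt ?sqr_ge0//.
rewrite expr2 {1}/l1norm mulr_suml ler_sum// => i _.
rewrite -real_normK ?num_real// expr2 ler_wpM2l//.
by rewrite /l1norm (bigD1 i)//= lerDl sumr_ge0.
Qed.

Lemma path_l1norm h n q : q \in paths h n ->
  l1norm q.1.2 <= n%:R * \sum_(y <- supp) l1norm y.
Proof.
elim: n q => [|n ihn] q /=.
  by rewrite inE => /eqP -> /=; rewrite l1norm0 mul0r.
move=> /allpairsP[[y q'] [/= ys q'P ->]] /=.
rewrite (le_trans (l1normD _ _))// -natr1 mulrDl mul1r addrC lerD ?ihn//.
rewrite (bigD1_seq y) ?fset_uniq//=.
by rewrite lerDl sumr_ge0// => z _; exact: l1norm_ge0.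
Qed.

Lemma sum_path_linear h n : \sum_(y <- supp) p y * h y = 0 ->
  \sum_(q <- paths h n) q.1.1 * q.2 = 0.
Proof.
move=> h0; elim: n => [|n ihn] /=; first by rewrite big_seq1 mulr0.
rewrite big_allpairs_dep (eq_bigr (fun y => p y * h y)) => [//|y _] /=.
transitivity (\sum_(q <- paths h n) ((p y * h y) * q.1.1 + p y * (q.1.1 * q.2))).
  by apply: eq_bigr => q _ /=; ring.
by rewrite big_split/= -!mulr_sumr ihn sum_path_weight mulr0 addr0 mulr1.
Qed.

(** Variance of a sum of $n$ independent centred steps: the cross term vanishes by
    [sum_path_linear]. *)
Lemma sum_path_square h n : \sum_(y <- supp) p y * h y = 0 ->
  \sum_(q <- paths h n) q.1.1 * q.2 ^+ 2 =
  n%:R * \sum_(y <- supp) p y * h y ^+ 2.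
Proof.
move=> h0; elim: n => [|n ihn] /=; first by rewrite big_seq1 expr0n mulr0 mul0r.
rewrite big_allpairs_dep.
transitivity (\sum_(y <- supp) (p y * h y ^+ 2 +
   p y * \sum_(q <- paths h n) q.1.1 * q.2 ^+ 2)).
  apply: eq_bigr => y _ /=.
  transitivity (\sum_(q <- paths h n) ((p y * h y ^+ 2) * q.1.1
     + ((2 * p y * h y) * (q.1.1 * q.2) + p y * (q.1.1 * q.2 ^+ 2)))).
    by apply: eq_bigr => q _ /=; ring.
  rewrite !big_split/= -!mulr_sumr sum_path_weight (sum_path_linear _ h0).
  by rewrite mulr1 mulr0 add0r.
by rewrite big_split/= ihn -mulr_suml (sum_supp p_sum1) !mul1r -natr1 mulrDl mul1r addrC.
Qed.

(** The inequality $|s|\le a+s^2/a$ with $a=\sqrt n$ plays the part of Cauchy-Schwarz; $n=0$ is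
    separate because $a$ must be positive. *)
Lemma sum_path_abs h n : \sum_(y <- supp) p y * h y = 0 ->
  \sum_(q <- paths h n) q.1.1 * `|q.2| <=
  Num.sqrt n%:R * (1 + \sum_(y <- supp) p y * h y ^+ 2).
Proof.
move=> h0; case: n => [|n]; first by rewrite /= big_seq1/= normr0 mulr0 sqrtr0 mul0r.
set a := Num.sqrt n.+1%:R.
have a0 : 0 < a by rewrite sqrtr_gt0.
have aa : a ^+ 2 = n.+1%:R by rewrite sqr_sqrtr.
apply: (@le_trans _ _ (\sum_(q <- paths h n.+1)
    (a * q.1.1 + a^-1 * (q.1.1 * q.2 ^+ 2)))).
  rewrite big_seq [leRHS]big_seq; apply: ler_sum => q qP.
  have w0 := path_weight_ge0 qP.
  rewrite (_ : a * _ + _ = q.1.1 * (a + a^-1 * q.2 ^+ 2)); last by ring.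
  rewrite ler_wpM2l// -(@ler_pM2l _ a)// mulrDr mulVKf ?gt_eqF//.
  rewrite -(real_normK (num_real q.2)).
  have := normr_ge0 q.2; move: `|_| => r r0.
  by have := sqr_ge0 (a - r); have := sqr_ge0 a; have := sqr_ge0 r; nra.
rewrite big_split -!mulr_sumr sum_path_weight (sum_path_square _ h0) -aa.
by rewrite mulr1 mulrDr mulr1 expr2 !mulrA mulVf ?gt_eqF// mul1r.
Qed.

Definition score (a b y : Zd d) : R := (y == a)%:R / p a - (y == b)%:R / p b.

Lemma sum_score (a b : Zd d) (f : Zd d -> R) : a \in supp -> b \in supp ->
  \sum_(y <- supp) p y * score a b y * f y = f a - f b.
Proof.
have E c : c \in supp -> \sum_(y <- supp) p y * ((y == c)%:R / p c) * f y = f c.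
  move=> cs; rewrite (bigD1_seq c) ?fset_uniq//=.
  rewrite eqxx mul1r divff ?mul1r -?(mem_supp p_sum1)// big1 ?addr0//.
  by move=> y /negbTE ->; rewrite mul0r mulr0 mul0r.
move=> asupp bsupp; rewrite -[in RHS](E _ asupp) -[X in _ - X](E _ bsupp) -sumrB; apply: eq_bigr => y _.
by rewrite /score; ring.
Qed.

(* The signed measure p * score is delta_a - delta_b. Symmetrising which of the
   n steps carries the score makes n times the gradient an average of sums of n
   centred weights, whose absolute mean is of order sqrt n. *)
Lemma sum_path_score (a b : Zd d) n f x : a \in supp -> b \in supp ->
  \sum_(q <- paths (score a b) n) q.1.1 * q.2 * f (x + q.1.2) =
  n%:R * iter n.-1 (avg p) (fun z => f (z + a) - f (z + b)) x.
Proof.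
move=> asupp bsupp; elim: n x => [|n ihn] x /=.
  by rewrite big_seq1/= mulr0 !mul0r.
set g := fun z => f (z + a) - f (z + b).
rewrite big_allpairs_dep.
transitivity (\sum_(y <- supp) (p y * score a b y * iter n (avg p) f (x + y) +
    p y * (n%:R * iter n.-1 (avg p) g (x + y)))).
  apply: eq_bigr => y _ /=; rewrite -ihn (iter_avgE _ (score a b)) !mulr_sumr.
  by rewrite -big_split; apply: eq_bigr => q _ /=; rewrite addrA; ring.
rewrite big_split/= (sum_score (fun y => iter n (avg p) f (x + y)))//.
rewrite -!iter_avg_shift -iter_avgB -natr1 mulrDl mul1r addrC; congr (_ + _).
  (* At $n=0$ the truncated [n.-1] is harmless, being multiplied by 0; otherwise the new step
     supplies the one averaging that [n.-1] lacks. *)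
  case: n {ihn} => [|n]; first by rewrite mul0r big1// => y _; rewrite mul0r mulr0.
  rewrite iterS {2}/avg mulr_sumr; apply: eq_bigr => y _.
  by rewrite mulrCA.
Qed.

Lemma sum_score0 a b : a \in supp -> b \in supp ->
  \sum_(y <- supp) p y * score a b y = 0.
Proof.
move=> asupp bsupp.
transitivity (\sum_(y <- supp) p y * score a b y * 1).
  by apply: eq_bigr => y _; rewrite mulr1.
by rewrite (sum_score (fun=> 1))// subrr.
Qed.

End walk_gradient.

(** * Integrals of absolute values and squares *)

Section sequences_of_random_variables.
Context d (T : measurableType d) (R : realType).
Implicit Types f g h : T -> R.

(** Only countable quantifiers appear, which makes the set of convergence measurable. *)
Lemma cvgn_cauchyP (u : R^nat) : cvgn u <->
  forall k : nat, exists N, forall m, (N <= m)%N -> `|u m - u N| <= k.+1%:R^-1.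
Proof.
split=> [/cauchy_cvgP/cauchyP H k|H].
  have k0 : 0 < (k.+1%:R : R)^-1 / 2 by rewrite divr_gt0.
  have [x [N _ NH]] := H _ k0; exists N => m Nm.
  have := NH m Nm; have := NH N (leqnn N); rewrite /ball/= => h1 h2.
  rewrite (_ : u m - u N = (x - u N) - (x - u m)); last by ring.
  by rewrite (le_trans (ler_normB _ _))// [leRHS]splitr lerD// ltW.
apply/cauchy_cvgP/cauchyP => e e0.
have [k ke] : exists k : nat, k.+1%:R^-1 < e.
  exists (Num.truncn e^-1); rewrite invf_plt ?posrE//.
  by rewrite truncnS_gt.
have [N NH] := H k; exists (u N); exists N => // m /= Nm.
by rewrite /ball/= distrC (le_lt_trans (NH _ Nm)).
Qed.

Lemma measurable_cvgn (f : nat -> T -> R) :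
  (forall n, measurable_fun setT (f n)) ->
  measurable [set x | cvgn (fun n => f n x)].
Proof.
move=> mf; rewrite [X in measurable X](_ : _ = \bigcap_k \bigcup_N
  \bigcap_(m in [set m | (N <= m)%N]) [set x | `|f m x - f N x| <= k.+1%:R^-1]).
  apply: bigcapT_measurable => k; apply: bigcupT_measurable => N.
  apply: bigcap_measurable; first by exists N => /=.
  move=> m _; rewrite -[X in measurable X]setTI.
  have : measurable_fun setT (fun x => `|f m x - f N x|).
    by apply: measurableT_comp => //; exact: measurable_funB.
  move=> /(_ measurableT `]-oo, k.+1%:R^-1]%classic (measurable_itv _)).
  by congr (measurable (_ `&` _)); apply/seteqP; split => x; rewrite /= in_itv.
apply/seteqP; split => x /=.
  by move=> /cvgn_cauchyP H k _; have [N NH] := H k; exists N.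
move=> H; apply/cvgn_cauchyP => k; have [N _ NH] := H k I.
by exists N => m Nm; exact: NH.
Qed.

Lemma measurable_limn (f : nat -> T -> R) :
  (forall n, measurable_fun setT (f n)) ->
  measurable_fun setT (fun x => limn (fun n => f n x)).
Proof.
move=> mf; set C := [set x | cvgn (fun n => f n x)].
have mC : measurable C by exact: measurable_cvgn.
(* [limn] of a divergent sequence is [point]; functions set to [point] off the convergence set
   therefore converge everywhere to [limn]. *)
apply: (measurable_fun_cvg (h := fun n x => if x \in C then f n x else point)).
  move=> n; apply: measurable_fun_ifT => //.
  by apply: (measurable_fun_bool true); rewrite setTI [X in measurable X](_ : _ = C)//;
    apply/seteqP; split => x /=; [move/set_mem|move/mem_set].
move=> x _; have [xC|xC] := boolP (x \in C); first exact: (set_mem xC).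
rewrite dvgP; first exact: cvg_cst.
by move=> Cx; move: xC; rewrite notin_setE; exact.
Qed.

Variable mu : probability T R.
Local Open Scope ereal_scope.

(** First and second absolute moments are kept in the extended reals, so that estimates can be
    stated without integrability conditions. *)
Definition absint f : \bar R := \int[mu]_x (`|f x|%R)%:E.
Definition sqint f : \bar R := \int[mu]_x ((f x) ^+ 2)%:E.

Let mabs f : measurable_fun setT f -> measurable_fun setT (fun x => (`|f x|%R)%:E).
Proof. by move=> mf; apply/measurable_EFinP; exact: measurableT_comp. Qed.

Lemma integral_prob_cst (r : \bar R) : \int[mu]_x r = r.
Proof.
transitivity (r * mu setT); first exact: integral_cst.
by rewrite (probability_setT mu) mule1.
Qed.

Lemma absintB f g h : measurable_fun setT f -> measurable_fun setT g ->
  measurable_fun setT h ->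
  absint (fun x => f x - g x)%R <=
  absint (fun x => f x - h x)%R + absint (fun x => g x - h x)%R.
Proof.
move=> mf mg mh; rewrite -ge0_integralD//; last 2 first.
- by apply: mabs; exact: measurable_funB.
- by apply: mabs; exact: measurable_funB.
apply: ge0_le_integral => //.
- by apply: mabs; exact: measurable_funB.
- by apply: emeasurable_funD; apply: mabs; exact: measurable_funB.
move=> x _; rewrite -EFinD lee_fin.
rewrite (_ : (f x - g x) = (f x - h x) - (g x - h x))%R; last by ring.
exact: ler_normB.
Qed.

Lemma absintN f g : absint (fun x => f x - g x)%R = absint (fun x => g x - f x)%R.
Proof. by apply: eq_integral => x _; rewrite distrC. Qed.

Lemma absint_sum (I : eqType) (r : seq I) (c : I -> R) (f : I -> T -> R) :
  (forall i, measurable_fun setT (f i)) ->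
  absint (fun x => \sum_(i <- r) c i * f i x)%R <=
  \sum_(i <- r) (`|c i|%R)%:E * absint (f i).
Proof.
move=> mf.
rewrite (eq_bigr (fun i => \int[mu]_x ((`|c i|%R)%:E * (`|f i x|%R)%:E))); last first.
  by move=> i _; rewrite ge0_integralZl_EFin//; exact: mabs.
rewrite -ge0_integral_sum//; last first.
  by move=> i; apply: measurable_funeM; exact: mabs.
apply: ge0_le_integral => //.
- apply: mabs; apply: measurable_sum => i; apply: measurable_funM => //.
- apply: emeasurable_sum => i; apply: measurable_funeM; exact: mabs.
move=> x _; rewrite [leRHS](eq_bigr (fun i => (`|c i * f i x|%R)%:E)); last first.
  by move=> i _; rewrite normrM EFinM.
by rewrite sumEFin lee_fin ler_norm_sum.
Qed.

(** The pointwise bound $|f|\le a+f^2/a$. The free parameter avoids a square root: a second moment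
    of at most $a^2$ gives a mean of at most $2a$. *)
Lemma absint_le_sqint f a : measurable_fun setT f -> (0 < a)%R ->
  absint f <= a%:E + (a^-1)%:E * sqint f.
Proof.
move=> mf a0.
have mf2 : measurable_fun setT (fun x => (f x ^+ 2)%:E).
  by apply/measurable_EFinP; exact: measurable_funX.
rewrite -(integral_prob_cst a%:E).
rewrite -ge0_integralZl_EFin//; last 2 first.
- by move=> x _; rewrite lee_fin sqr_ge0.
- by rewrite invr_ge0 ltW.
rewrite -ge0_integralD//; last 3 first.
- by move=> x _; rewrite lee_fin ltW.
- by move=> x _; rewrite -EFinM lee_fin mulr_ge0 ?sqr_ge0// invr_ge0 ltW.
- exact: measurable_funeM.
apply: ge0_le_integral => //.
- exact: mabs.
- by apply: emeasurable_funD => //; exact: measurable_funeM.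
move=> x _; rewrite -EFinM -EFinD lee_fin -(@ler_pM2l _ a)// mulrDr mulVKf ?gt_eqF//.
rewrite -(real_normK (num_real (f x))).
have := normr_ge0 (f x); move: `|_|%R => r r0.
by have := sqr_ge0 (a - r); have := sqr_ge0 a; have := sqr_ge0 r; nra.
Qed.

(** Fatou's lemma for the lower limit in $m$ of $|f_m-f_n|$, which agrees almost everywhere with
    $|\lim f-f_n|$. *)
Lemma absint_lim (f : nat -> T -> R) n (e : R) :
  (forall n, measurable_fun setT (f n)) ->
  {ae mu, forall x, cvgn (fun n => f n x)} ->
  (forall m, (n <= m)%N -> absint (fun x => f m x - f n x)%R <= e%:E) ->
  absint (fun x => limn (fun n => f n x) - f n x)%R <= e%:E.
Proof.
move=> mf cvf He.
have mfn m : measurable_fun setT (fun x => (`|f m x - f n x|%R)%:E).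
  by apply: mabs; exact: measurable_funB.
have ml : measurable_fun setT (fun x => (`|limn (fun m => f m x) - f n x|%R)%:E).
  by apply: mabs; apply: measurable_funB => //; exact: measurable_limn.
have mi : measurable_fun setT (fun x => limn_einf (fun m => (`|f m x - f n x|%R)%:E)).
  rewrite (_ : (fun x => _) = (fun x => - limn_esup (fun m => - (`|f m x - f n x|%R)%:E))).
    apply: measurableT_comp => //; apply: measurable_fun_limn_esup => m.
    exact: measurableT_comp.
  apply/funext => x.
  by rewrite (limn_esupN (fun m => (`|f m x - f n x|%R)%:E)) oppeK.
rewrite /absint (@ge0_ae_eq_integral _ _ _ mu setT _
  (fun x => limn_einf (fun m => (`|f m x - f n x|%R)%:E)))//.
- apply: (le_trans (fatou _ _ _ _)) => //.
  rewrite limn_einf_lim; apply: lime_le; first exact: is_cvg_einfs.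
  exists n => // m /= nm.
  apply: (le_trans (ereal_inf_lbound _)); last exact: (He m nm).
  by exists m => /=.
- move=> x _; rewrite limn_einf_lim; apply: lime_ge; first exact: is_cvg_einfs.
  by apply: nearW => m; apply: le_ereal_inf_tmp => _ [k _ <-]; rewrite lee_fin.
- apply: filterS cvf => x cvx _ /=; apply/esym.
  have : (fun m => (`|f m x - f n x|%R)%:E) @ \oo -->
      (`|limn (fun m => f m x) - f n x|%R)%:E.
    apply: cvg_EFin; first by apply: nearW.
    apply: cvg_norm; apply: cvgB; last exact: cvg_cst.
    exact: cvx.
  by move=> /cvg_limn_einf_sup[].
Qed.

End sequences_of_random_variables.

Section summability.
Variable R : realType.

Lemma summable_tail (c : nat -> R) C : (forall k, 0 <= c k) ->
  (forall n, \sum_(0 <= k < n) c k <= C) ->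
  forall e, 0 < e -> exists m, forall n, \sum_(m <= k < n) c k <= e.
Proof.
move=> c0 cC e e0.
pose S := range (fun n => \sum_(0 <= k < n) c k).
have hS : has_sup S.
  split; first by exists (\sum_(0 <= k < 0) c k); exists 0%N.
  by exists C => _ [n _ <-].
have [_ [m _ <-] mS] := sup_adherent e0 hS.
exists m => n; have [nm|mn] := leqP n m; first by rewrite big_geq// ltW.
have : \sum_(0 <= k < n) c k <= sup S.
  by apply: sup_upper_bound => //; exists n.
rewrite (big_cat_nat (leq0n m) (ltnW mn))/= => h.
by rewrite -(lerD2l (\sum_(0 <= k < m) c k)) (le_trans h)// -lerBlDr ltW.
Qed.

Lemma geometric_half_le n : \sum_(0 <= k < n) (2^-1 : R) ^+ k <= 2.
Proof.
suff : \sum_(0 <= k < n) (2^-1 : R) ^+ k = 2 - 2 * 2^-1 ^+ n.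
  by move=> ->; rewrite gerBl mulr_ge0// exprn_ge0.
elim: n => [|n ihn]; first by rewrite big_geq// expr0; lra.
by rewrite big_nat_recr//= ihn exprS; lra.
Qed.

End summability.

Section fast_cauchy.
Context d (T : measurableType d) (R : realType) (mu : probability T R).
Variables (f : nat -> T -> R) (e : nat -> R) (C : R).
Hypothesis mf : forall n, measurable_fun setT (f n).
Hypothesis fe : forall n, (absint mu (fun x => f n.+1 x - f n x)%R <= (e n)%:E)%E.
Hypothesis eC : forall n, \sum_(0 <= k < n) e k <= C.
Local Open Scope ereal_scope.

(** The sum of the absolute increments has integral at most [C], hence is finite almost
    everywhere. *)
Lemma fast_cauchy_cvgn : {ae mu, forall x, cvgn (fun n => f n x)}.
Proof.
pose g n x := (`|f n.+1 x - f n x|%R)%:E.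
have mg n : measurable_fun setT (g n).
  by apply/measurable_EFinP; apply: measurableT_comp => //; exact: measurable_funB.
have g0 n x : 0 <= g n x by rewrite lee_fin.
have iG : mu.-integrable setT (fun x => \sum_(0 <= n <oo) g n x).
  apply/integrableP; split.
    by apply: ge0_emeasurable_sum.
  rewrite (eq_integral (fun x => \sum_(0 <= n <oo) g n x)); last first.
    by move=> x _; rewrite gee0_abs// nneseries_ge0.
  rewrite integral_nneseries//.
  apply: (@le_lt_trans _ _ C%:E); last exact: ltry.
  apply: lime_le.
    by apply: is_cvg_nneseries => n _ _; apply: integral_ge0 => x _.
  apply: nearW => n; apply: (@le_trans _ _ (\sum_(0 <= k < n) (e k)%:E)).
    by apply: lee_sum => k _; exact: fe.
  by rewrite sumEFin lee_fin.
have := integrable_ae measurableT iG; apply: filterS => x /(_ I) gx.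
have cs : cvgn (series (fun n => f n.+1 x - f n x)%R).
  apply: normed_cvg; apply: nondecreasing_is_cvgn.
    apply/nondecreasing_seqP => n.
    by rewrite /series/= [leRHS]big_nat_recr//= lerDl.
  exists (fine (\sum_(0 <= n <oo) g n x)) => _ [n _ <-].
  rewrite -lee_fin fineK// /series/= -sumEFin.
  exact: nneseries_lim_ge.
rewrite (_ : (fun n => _) = (fun n => f 0%N x + series (fun n => f n.+1 x - f n x) n)%R).
  by apply: is_cvgD => //; exact: is_cvg_cst.
apply/funext => n; rewrite /series/= telescope_sumr// addrC subrK//.
Qed.

End fast_cauchy.

(** * Second moments under independence *)

Lemma iid_field_ge0_integral (J : choiceType) (R : realType) (m : set R -> \bar R)
    d (T : measurableType d) (mu : probability T R) (Y : T -> prodR J R)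
    d' (T' : measurableType d') (mu' : probability T' R) (Y' : T' -> prodR J R)
    (F : prodR J R -> \bar R) :
  iid_field m mu Y -> iid_field m mu' Y' ->
  measurable_fun setT F -> (forall s, 0 <= F s)%E ->
  (\int[mu]_t F (Y t) = \int[mu']_t F (Y' t))%E.
Proof.
move=> iY iY' mF F0.
rewrite -(ge0_integral_law mu iY.1 mF F0) -(ge0_integral_law mu' iY'.1 mF F0).
by apply: eq_measure_integral => A mA _; exact: (iid_field_eq_law iY iY').
Qed.

Section independent_increments.
Variables (J : choiceType) (R : realType) (m : set R -> \bar R).
Local Notation S := (prodR J R).
Variable Lam : probability S R.
Hypothesis iid : iid_field m Lam id.
Local Open Scope ereal_scope.

(** [X] is centred and reads only coordinates outside [b], while [T] and [Y] read only those in [b];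
    the cross term thus integrates to 0. The bounded multiplier [Y] leaves room for a stopping
    indicator. *)
Lemma sqint_add_independent (b : pred J) (T Y X : S -> R) :
  measurable_fun setT T -> measurable_fun setT Y -> measurable_fun setT X ->
  (forall s s', {in b, s =1 s'} -> T s = T s') ->
  (forall s s', {in b, s =1 s'} -> Y s = Y s') ->
  (forall s s', {in predC b, s =1 s'} -> X s = X s') ->
  (forall s, `|Y s| <= 1)%R ->
  Lam.-integrable setT (EFin \o X) -> \int[Lam]_s (X s)%:E = 0 ->
  sqint Lam X < +oo ->
  sqint Lam (fun s => T s + Y s * X s)%R <= sqint Lam T + sqint Lam X.
Proof.
move=> mT mY mX bT bY bX Y1 iX X0 X2.
pose mix (t : S * S) : S := fun j => if b j then t.1 j else t.2 j.
have imix : iid_field m (Lam \x Lam) mix by exact: (iid_field_mix b iid iid).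
have mF : measurable_fun setT (fun s => ((T s + Y s * X s) ^+ 2)%:E).
  apply/measurable_EFinP; apply: measurable_funX; apply: measurable_funD => //.
  exact: measurable_funM.
have mX2 : measurable_fun setT (fun s => (X s ^+ 2)%:E).
  by apply/measurable_EFinP; exact: measurable_funX.
have mT2 : measurable_fun setT (fun s => (T s ^+ 2)%:E).
  by apply/measurable_EFinP; exact: measurable_funX.
have iX2 : Lam.-integrable setT (fun s => (X s ^+ 2)%:E).
  apply/integrableP; split => //.
  rewrite (eq_integral (fun s => (X s ^+ 2)%:E))// => s _.
  by rewrite gee0_abs// lee_fin sqr_ge0.
have F0 s : 0 <= ((T s + Y s * X s) ^+ 2)%:E by rewrite lee_fin sqr_ge0.
rewrite /sqint (iid_field_ge0_integral iid imix mF F0).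
rewrite (fubini_tonelli1 (fun t => ((T (mix t) + Y (mix t) * X (mix t)) ^+ 2)%:E))//; last first.
  exact: (measurableT_comp mF imix.1).
rewrite -[X in _ + X](integral_prob_cst Lam) -[leRHS]ge0_integralD//; last 2 first.
- by move=> s _; rewrite lee_fin sqr_ge0.
- by move=> s _; apply: integral_ge0 => t _; rewrite lee_fin sqr_ge0.
apply: ge0_le_integral => //.
- by move=> s _; apply: integral_ge0 => t _; rewrite lee_fin sqr_ge0.
- apply: (measurable_fun_fubini_tonelli_F (m2 := Lam)
    (fun t => ((T (mix t) + Y (mix t) * X (mix t)) ^+ 2)%:E)).
    exact: (measurableT_comp mF imix.1).
  by move=> t; exact: F0.
- by apply: emeasurable_funD => //; exact: measurable_cst.
move=> s _; rewrite /fubini_F.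
(* With [s] frozen, [T] and [Y] are constants and [X] depends on [s'] alone, so the square expands
   into moments of [X]. *)
rewrite (eq_integral (fun s' => (T s ^+ 2)%:E + ((2 * T s * Y s)%:E * (X s')%:E
   + (Y s ^+ 2)%:E * (X s' ^+ 2)%:E))); last first.
  move=> s' _; rewrite -!EFinM -!EFinD; congr EFin.
  have -> : T (mix (s, s')) = T s.
    by apply: bT => j jb; rewrite /mix (jb : b j).
  have -> : Y (mix (s, s')) = Y s.
    by apply: bY => j jb; rewrite /mix (jb : b j).
  have -> : X (mix (s, s')) = X s'.
    by apply: bX => j jb; rewrite /mix (negbTE (jb : ~~ b j)).
  by ring.
have i1 : Lam.-integrable setT (fun s' => (2 * T s * Y s)%:E * (X s')%:E).
  exact: integrableZl.
have i2 : Lam.-integrable setT (fun s' => (Y s ^+ 2)%:E * (X s' ^+ 2)%:E).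
  exact: integrableZl.
have i0 : Lam.-integrable setT (fun=> (T s ^+ 2)%:E).
  exact: finite_measure_integrable_cst.
rewrite integralD//; last exact: integrableD.
rewrite integralD// integral_prob_cst integralZl// X0 mule0 add0e.
rewrite leeD2l// integralZl//.
rewrite -[leRHS]mul1e lee_wpmul2r//.
  by apply: integral_ge0 => t _; rewrite lee_fin sqr_ge0.
by rewrite lee_fin -(real_normK (num_real _)) expr_le1.
Qed.

End independent_increments.

(** * Series of independent random variables *)

Section independent_series.
Variables (Z : choiceType) (R : realType) (m : set R -> \bar R).
Local Notation S := (prodR (nat * Z)%type R).
Variable Lam : probability S R.
Hypothesis iid : iid_field m Lam id.
Variables (X : nat -> S -> R) (c : nat -> R).
Hypothesis mX : forall k, measurable_fun setT (X k).
Hypothesis layerX : forall k s s', (forall z, s (k, z) = s' (k, z)) -> X k s = X k s'.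
Hypothesis iX : forall k, Lam.-integrable setT (EFin \o X k).
Hypothesis X0 : forall k, (\int[Lam]_s (X k s)%:E = 0)%E.
Hypothesis X2 : forall k, (sqint Lam (X k) <= (c k)%:E)%E.

Let psum a n s := \sum_(a <= k < n) X k s.

Let mpsum a n : measurable_fun setT (psum a n).
Proof. exact: measurable_sum. Qed.

Let X2_lty k : (sqint Lam (X k) < +oo)%E.
Proof. by rewrite (le_lt_trans (X2 k))// ltry. Qed.

Lemma sqint_independent_sum a n :
  (sqint Lam (fun s => \sum_(a <= k < n) X k s)%R <=
   (\sum_(a <= k < n) c k)%R%:E)%E.
Proof.
have [na|an] := leqP n a.
  rewrite big_geq// /sqint integral0_eq// => s _.
  by rewrite big_geq// expr0n.
elim: n an => [//|n ihn]; rewrite ltnS => an.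
have ih : (sqint Lam (psum a n) <= (\sum_(a <= k < n) c k)%R%:E)%E.
  move: an; rewrite leq_eqVlt => /predU1P[<-|/ihn//].
  rewrite big_geq// /sqint integral0_eq// => s _.
  by rewrite /psum big_geq// expr0n.
rewrite big_nat_recr//= EFinD.
rewrite (_ : (fun s => _) = (fun s => psum a n s + 1 * X n s)); last first.
  by apply/funext => s; rewrite big_nat_recr//= mul1r.
apply: (le_trans (sqint_add_independent iid (b := fun j => (j.1 < n)%N)
  (mpsum _ _) _ (mX n) _ _ _ _ _ _ _)) => //.
- move=> s s' ss'; apply: eq_big_nat => k /andP[_ kn].
  by apply: layerX => z; exact: ss'.
- move=> s s' ss'; apply: layerX => z; apply: ss'.
  by rewrite inE/= ltnn.
- by move=> s; rewrite normr1.
- exact: leeD.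
Qed.

Section maximal_inequality.
Variables (a : nat) (eps : R).
Hypothesis eps0 : 0 < eps.

(* the partial sums from a on, frozen at the first exit from ]-eps, eps[ *)
Fixpoint stopped (n : nat) (s : S) : R :=
  if n is n'.+1 then
    stopped n' s + (if `|stopped n' s| < eps then 1 else 0) * X (a + n')%N s
  else 0.

Let measurable_alive (f : S -> R) : measurable_fun setT f ->
  measurable_fun setT (fun s : S => (if `|f s| < eps then 1 else 0) : R).
Proof.
move=> mf; apply: measurable_fun_ifT => //.
by apply: measurable_fun_ltr => //; exact: measurableT_comp.
Qed.

Let measurable_stopped n : measurable_fun setT (stopped n).
Proof.
elim: n => [|n ihn] /=; first exact: measurable_cst.
apply: measurable_funD => //; apply: measurable_funM => //.
exact: measurable_alive.
Qed.

Let stopped_past n s s' :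
  {in (fun j : nat * Z => (j.1 < a + n)%N), s =1 s'} -> stopped n s = stopped n s'.
Proof.
elim: n s s' => [//|n ihn] s s' ss' /=.
rewrite (ihn s s'); last first.
  by move=> j jn; apply: ss'; rewrite -topredE/= addnS ltnS ltnW.
congr (_ + _ * _); apply: layerX => z; apply: ss'.
by rewrite -topredE/= addnS.
Qed.

(** Whether the sum is still running is decided by layers below $a+n$, so the indicator is an
    admissible multiplier for the next term. *)
Lemma sqint_stopped n :
  (sqint Lam (stopped n) <= (\sum_(a <= k < a + n) c k)%R%:E)%E.
Proof.
elim: n => [|n ihn] /=.
  rewrite addn0 big_geq// /sqint integral0_eq// => s _.
  by rewrite expr0n.
rewrite addnS big_nat_recr/= ?leq_addr// EFinD.
apply: (le_trans (sqint_add_independent iid (b := fun j => (j.1 < a + n)%N)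
  (measurable_stopped _) _ (mX _) _ _ _ _ _ _ _)) => //.
- exact: measurable_alive.
- exact: stopped_past.
- by move=> s s' ss'; rewrite (stopped_past ss').
- move=> s s' ss'; apply: layerX => z; apply: ss'.
  by rewrite inE/= ltnn.
- by move=> s; case: ifP => _; rewrite ?normr1 ?normr0.
- exact: leeD.
Qed.

Lemma stopped_exit n s : (exists2 i, (i <= n)%N & eps <= `|psum a (a + i) s|) ->
  eps <= `|stopped n s|.
Proof.
(* Invariant of the recursion: either the exit has occurred and the stopped sum keeps its large
   value, or no exit has occurred and nothing was frozen. *)
suff H : (eps <= `|stopped n s|) \/ (stopped n s = psum a (a + n) s /\
    forall i, (i <= n)%N -> `|psum a (a + i) s| < eps).
  move=> [i ni hi]; case: H => [//|[_ /(_ i ni)]].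
  by rewrite ltNge hi.
elim: n => [|n ihn] /=.
  right; rewrite /psum addn0 big_geq//; split => // i.
  by rewrite leqn0 => /eqP ->; rewrite addn0 big_geq// normr0.
case: ihn => [h|[e h]].
  by left; rewrite ltNge h/= mul0r addr0.
have E : stopped n s + (if `|stopped n s| < eps then 1 else 0) * X (a + n)%N s
    = psum a (a + n.+1) s.
  by rewrite e h// mul1r /psum addnS [RHS]big_nat_recr//= leq_addr.
rewrite E; have [h'|h'] := leP eps `|psum a (a + n.+1) s|; [by left|right].
split=> // i; rewrite leq_eqVlt => /predU1P[->//|].
by rewrite ltnS; exact: h.
Qed.

(** Chebyshev's inequality for the stopped sum at a finite horizon, then continuity from below in
    the horizon. *)
Lemma kolmogorov_maximal (C : R) : (forall n, \sum_(a <= k < n) c k <= C) ->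
  (Lam (\bigcup_i [set s | (eps <= `|psum a (a + i) s|)%R]) <=
   (C / eps ^+ 2)%:E)%E.
Proof.
move=> cC.
pose E n := \bigcup_(i in [set i | (i <= n)%N]) [set s | eps <= `|psum a (a + i) s|].
have m1 (f : S -> R) : measurable_fun setT f -> measurable [set s | eps <= `|f s|].
  move=> mf; rewrite -[X in measurable X]setTI.
  have : measurable_fun setT (fun s => `|f s|) by exact: measurableT_comp.
  move=> /(_ measurableT `[eps, +oo[%classic (measurable_itv _)).
  congr (measurable (_ `&` _)); apply/seteqP.
  by split => s; rewrite /= in_itv/= andbT.
have mE n : measurable (E n) by apply: bigcup_measurable => i _; exact: m1.
have -> : \bigcup_i [set s | eps <= `|psum a (a + i) s|] = \bigcup_n E n.
  apply/seteqP; split => s; first by move=> [i _ h]; exists i => //; exists i => /=.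
  by move=> [n _ [i _ h]]; exists i.
have cv := @nondecreasing_cvg_mu _ _ _ Lam E mE (bigcup_measurable (fun n _ => mE n)).
have nd : nondecreasing_seq E.
  move=> n n' nn'; apply/subsetPset => s [i /= ni h]; exists i => //=.
  exact: leq_trans nn'.
have {}cv := cv nd.
rewrite -(cvg_lim _ cv)//; apply: lime_le; first by apply/cvg_ex; eexists; exact: cv.
apply: nearW => n /=.
apply: (@le_trans _ _ (Lam [set s | eps <= `|stopped n s|])).
  apply: le_measure; rewrite ?inE//; first exact: m1.
  by move=> s [i /= ni h]; apply: stopped_exit; exists i.
have e2 : 0 < eps ^+ 2 by rewrite exprn_gt0.
have mA := m1 _ (measurable_stopped n).
have -> : Lam [set s | eps <= `|stopped n s|] =
    (\int[Lam]_s (\1_[set s | eps <= `|stopped n s|] s)%:E)%E.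
  by rewrite integral_indic// setIT.
apply: (@le_trans _ _ ((eps ^- 2)%:E * sqint Lam (stopped n)))%E.
  rewrite -ge0_integralZl_EFin//; last 3 first.
  - by move=> s _; rewrite lee_fin sqr_ge0.
  - by apply/measurable_EFinP; exact: measurable_funX.
  - by rewrite invr_ge0 ltW.
  apply: ge0_le_integral => //.
  - by apply/measurable_EFinP; exact: measurable_indic.
  - apply: measurable_funeM; apply/measurable_EFinP; exact: measurable_funX.
  move=> s _; rewrite -EFinM lee_fin indicE; case: (boolP (s \in _)) => sA.
    rewrite mulrC ler_pdivlMr// mul1r -(real_normK (num_real (stopped n s))).
    by move: sA; rewrite inE /= => sA; rewrite lerXn2r ?nnegrE// ltW.
  by rewrite mulr_ge0 ?sqr_ge0// invr_ge0 ltW.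
rewrite EFinM muleC lee_wpmul2r//; first by rewrite lee_fin invr_ge0 ltW.
by rewrite (le_trans (sqint_stopped n))// lee_fin.
Qed.

End maximal_inequality.

Hypothesis c0 : forall k, 0 <= c k.
Variable C : R.
Hypothesis cC : forall n, \sum_(0 <= k < n) c k <= C.

Lemma independent_series_cvgn :
  {ae Lam, forall s, cvgn (fun n => \sum_(0 <= k < n) X k s)}.
Proof.
(* Divergence means that for some [k] the sums from every start [a] reach size $1/(k+1)$. *)
pose E a k := \bigcup_i [set s | (k.+1%:R^-1 : R) <= `|psum a (a + i) s|].
have mE a k : measurable (E a k).
  apply: bigcup_measurable => i _; rewrite -[X in measurable X]setTI.
  have : measurable_fun setT (fun s => `|psum a (a + i) s|) by exact: measurableT_comp.
  move=> /(_ measurableT `[k.+1%:R^-1, +oo[%classic (measurable_itv _)).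
  congr (measurable (_ `&` _)); apply/seteqP.
  by split => s; rewrite /= in_itv/= andbT.
have : Lam.-negligible (\bigcup_k \bigcap_a E a k).
  apply: negligible_bigcup => k.
  have mI : measurable (\bigcap_a E a k) by exact: bigcapT_measurable.
  apply/negligibleP => //; apply/eqP; rewrite eq_le measure_ge0 andbT.
  apply/lee_addgt0Pr => e e0; rewrite add0e.
  have k0 : 0 < (k.+1%:R^-1 : R) by rewrite invr_gt0.
  have ek0 : 0 < e * k.+1%:R^-1 ^+ 2 by rewrite mulr_gt0// exprn_gt0.
  (* The start [a] makes the tail variance at most $e/(k+1)^2$, which the maximal inequality turns
     into probability at most $e$. *)
  have [a ha] := summable_tail c0 cC ek0.
  apply: (@le_trans _ _ (Lam (E a k))).
    by apply: le_measure; rewrite ?inE//; exact: bigcap_inf.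
  apply: (le_trans (kolmogorov_maximal k0 ha)).
  by rewrite mulfK// expf_neq0// gt_eqF.
apply: negligibleS => s /= ncv; apply: contrapT => nE; apply: ncv.
apply/cvgn_cauchyP => k; apply: contrapT => nk; apply: nE.
exists k => // a _; apply: contrapT => nE; apply: nk; exists a => n an.
rewrite leNgt; apply/negP => h; apply: nE; exists (n - a)%N => //=.
rewrite subnKC// ltW// (lt_le_trans h)//.
by rewrite (big_cat_nat (leq0n a) an)/= addrC addrK.
Qed.

End independent_series.

(** * Variance of the gradient of the averaged noise *)

Section centred_random_variables.
Context d (T : measurableType d) (R : realType) (mu : probability T R).
Implicit Types f g : T -> R.
Local Open Scope ereal_scope.

Definition centred f : Prop :=
  [/\ measurable_fun setT f, mu.-integrable setT (EFin \o f),
      \int[mu]_x (f x)%:E = 0 & sqint mu f < +oo].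

Lemma sqintB_le f g : measurable_fun setT f -> measurable_fun setT g ->
  sqint mu (fun x => f x - g x)%R <= 2%:E * sqint mu f + 2%:E * sqint mu g.
Proof.
move=> mf mg.
have m2 (h : T -> R) : measurable_fun setT h -> measurable_fun setT (fun x => (h x ^+ 2)%:E).
  by move=> mh; apply/measurable_EFinP; exact: measurable_funX.
have p2 (h : T -> R) x : 0 <= (h x ^+ 2)%:E by rewrite lee_fin sqr_ge0.
rewrite -ge0_integralZl_EFin//; last exact: m2.
rewrite -ge0_integralZl_EFin//; last exact: m2.
rewrite -ge0_integralD//; last 4 first.
- by move=> x _; rewrite -EFinM lee_fin mulr_ge0// sqr_ge0.
- by apply: measurable_funeM; exact: m2.
- by move=> x _; rewrite -EFinM lee_fin mulr_ge0// sqr_ge0.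
- by apply: measurable_funeM; exact: m2.
apply: ge0_le_integral => //.
- by move=> x _; rewrite lee_fin sqr_ge0.
- by apply: m2; exact: measurable_funB.
- by apply: emeasurable_funD; apply: measurable_funeM; exact: m2.
move=> x _; rewrite -!EFinM -EFinD lee_fin.
by have := sqr_ge0 (f x + g x)%R; nra.
Qed.

Lemma sqintZ a f : measurable_fun setT f ->
  sqint mu (fun x => a * f x)%R = (a ^+ 2)%:E * sqint mu f.
Proof.
move=> mf; rewrite -ge0_integralZl_EFin ?sqr_ge0//; last 2 first.
- by move=> x _; rewrite lee_fin sqr_ge0.
- by apply/measurable_EFinP; exact: measurable_funX.
by apply: eq_integral => x _; rewrite -EFinM exprMn.
Qed.

Lemma sqint_ge0 f : 0 <= sqint mu f.
Proof. by apply: integral_ge0 => x _; rewrite lee_fin sqr_ge0. Qed.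

Lemma centredB f g : centred f -> centred g -> centred (fun x => f x - g x)%R.
Proof.
move=> [mf jf f0 f2] [mg jg g0 g2]; split.
- exact: measurable_funB.
- rewrite (_ : _ \o _ = (EFin \o f) \- (EFin \o g)); first exact: integrableB.
  by apply/funext => x /=; rewrite EFinB.
- under eq_integral do rewrite EFinB.
  by rewrite integralB// f0 g0 sube0.
- rewrite (le_lt_trans (sqintB_le mf mg))// lte_add_pinfty// lte_mul_pinfty//.
Qed.

Lemma centredZ a f : centred f -> centred (fun x => a * f x)%R.
Proof.
move=> [mf jf f0 f2]; split.
- exact: measurable_funM.
- rewrite (_ : _ \o _ = (fun x => a%:E * (EFin \o f) x)); first exact: integrableZl.
  by apply/funext => x /=; rewrite EFinM.
- under eq_integral do rewrite EFinM.
  by rewrite integralZl// f0 mule0.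
- by rewrite sqintZ// lte_mul_pinfty// ?lee_fin ?sqr_ge0.
Qed.

Lemma centred0 : centred (fun=> 0)%R.
Proof.
split.
- exact: measurable_cst.
- exact: integrable0.
- exact: integral0.
- rewrite /sqint (eq_integral (fun=> 0)) ?integral0// => x _.
  by rewrite expr0n.
Qed.

Lemma centred_sum (I : Type) (r : seq I) (f : I -> T -> R) :
  (forall i, centred (f i)) -> centred (fun x => \sum_(i <- r) f i x)%R.
Proof.
move=> cf; elim: r => [|i r ihr].
  by rewrite (_ : (fun x => _) = (fun=> 0)%R)//; [exact: centred0|
    apply/funext => x; rewrite big_nil].
rewrite (_ : (fun x => _) = (fun x => f i x - (-1) * \sum_(i <- r) f i x)%R).
  by apply: centredB => //; exact: centredZ.
by apply/funext => x; rewrite big_cons mulN1r opprK.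
Qed.

End centred_random_variables.

Section noise.
Variables (R : realType) (d : nat) (p : Zd d -> R).
Hypothesis p_ge0 : forall x, 0 <= p x.
Hypothesis p_sum1 : \sum_(x \in [set: Zd d]) p x = 1.
Hypothesis aper : strongly_aperiodic p.
Variable m : set R -> \bar R.
Local Notation S := (prodR (nat * Zd d)%type R).
Variable Lam : probability S R.
Hypothesis iid : iid_field m Lam id.
Hypothesis centred_coord : forall j, centred Lam (fun s : S => s j).
Local Notation A k f x := (iter k (avg p) f x).

Lemma centred_avg k l x : centred Lam (fun s : S => A k (fun z => s (l, z)) x).
Proof.
rewrite (_ : (fun s => _) =
    (fun s : S => \sum_(q <- paths p (fun=> 0) k) q.1.1 * s (l, x + q.1.2))).
  by apply: centred_sum => q; exact: centredZ.
by apply/funext => s; rewrite (iter_avgE _ (fun=> 0)).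
Qed.

Lemma centred_avgB k l x y :
  centred Lam (fun s : S => A k (fun z => s (l, z)) x - A k (fun z => s (l, z)) y).
Proof. by apply: centredB; exact: centred_avg. Qed.

Lemma sqint_reindex (phi : nat * Zd d -> nat * Zd d) (F : S -> R) :
  injective phi -> measurable_fun setT F ->
  sqint Lam (fun s => F (fun j => s (phi j))) = sqint Lam F.
Proof.
move=> iphi mF.
have m2 : measurable_fun setT (fun s => (F s ^+ 2)%:E).
  by apply/measurable_EFinP; exact: measurable_funX.
have p2 s : (0 <= (F s ^+ 2)%:E)%E by rewrite lee_fin sqr_ge0.
exact: (iid_field_ge0_integral (iid_field_reindex iphi iid) iid m2 p2).
Qed.

(** Layer 0 represents all layers, since relabelling the layers of an i.i.d. field preserves its
    law. *)
Definition gradvar k x y : \bar R :=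
  sqint Lam (fun s : S => A k (fun z => s (0%N, z)) x - A k (fun z => s (0%N, z)) y).

Lemma gradvar_layer k l x y :
  sqint Lam (fun s : S => A k (fun z => s (l, z)) x - A k (fun z => s (l, z)) y) =
  gradvar k x y.
Proof.
have [mF _ _ _] := centred_avgB k 0 x y.
apply: (sqint_reindex (phi := fun j => ((j.1 + l)%N, j.2)) _ mF).
by move=> [a z] [b z'] [/addIn -> ->].
Qed.

Lemma gradvar_shift k t x y : gradvar k (x + t) (y + t) = gradvar k x y.
Proof.
have [mF _ _ _] := centred_avgB k 0 x y.
rewrite -[RHS](sqint_reindex (phi := fun j => (j.1, j.2 + t)) _ mF); last first.
  by move=> [a z] [b z'] [-> /addIr ->].
rewrite /gradvar; congr sqint; apply/funext => s /=.
by rewrite -!iter_avg_shift.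
Qed.

Lemma sqint_avg_shift k x :
  sqint Lam (fun s : S => A k (fun z => s (0%N, z)) x) =
  sqint Lam (fun s : S => A k (fun z => s (0%N, z)) 0).
Proof.
have [mF _ _ _] := centred_avg k 0 0.
rewrite -[RHS](sqint_reindex (phi := fun j => (j.1, j.2 + x)) _ mF); last first.
  by move=> [a z] [b z'] [-> /addIr ->].
congr sqint; apply/funext => s /=.
by rewrite -[in LHS](add0r x) -iter_avg_shift.
Qed.

Lemma gradvar_fin k x y : gradvar k x y \is a fin_num.
Proof.
have [_ _ _ ?] := centred_avgB k 0 x y.
by rewrite ge0_fin_numE// sqint_ge0.
Qed.

Lemma gradvar_ge0 k x y : (0 <= gradvar k x y)%E.
Proof. exact: sqint_ge0. Qed.

Lemma supp_term_le (F : Zd d -> R) c : (forall y, 0 <= F y) ->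
  p c * F c <= \sum_(y <- supp p) p y * F y.
Proof.
move=> F0; have pF y : 0 <= p y * F y by rewrite mulr_ge0.
have [cs|] := boolP (c \in supp p).
  by rewrite (bigD1_seq c) ?fset_uniq//= lerDl sumr_ge0.
by rewrite (mem_supp p_sum1) negbK => /eqP ->; rewrite mul0r sumr_ge0.
Qed.

Lemma p_le1 c : p c <= 1.
Proof.
have := @supp_term_le (fun=> 1) c (fun=> ler01); rewrite mulr1.
by under eq_bigr do rewrite mulr1; rewrite (sum_supp p_sum1).
Qed.

(** The gap in Jensen's inequality is the variance of [Y] under [p]. It dominates $p(a)p(b)$ times
    each of $(Y_a-M)^2$ and $(Y_b-M)^2$, and $(x-y)^2\le 2x^2+2y^2$ yields the factor $1/4$. *)
Lemma jensen_gap (Y : Zd d -> R) a b :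
  (\sum_(y <- supp p) p y * Y y) ^+ 2 + p a * p b / 4 * (Y a - Y b) ^+ 2 <=
  \sum_(y <- supp p) p y * Y y ^+ 2.
Proof.
set M := \sum_(y <- supp p) p y * Y y.
have -> : \sum_(y <- supp p) p y * Y y ^+ 2 =
    M ^+ 2 + \sum_(y <- supp p) p y * (Y y - M) ^+ 2.
  rewrite (eq_bigr (fun y => p y * (Y y - M) ^+ 2 + (2 * M * (p y * Y y) - M ^+ 2 * p y))).
    by rewrite big_split/= sumrB -!mulr_sumr (sum_supp p_sum1) -/M; ring.
  by move=> y _; ring.
rewrite lerD2l.
have H c := @supp_term_le (fun y => (Y y - M) ^+ 2) c (fun y => sqr_ge0 _).
have := H a; have := H b; have := p_le1 a; have := p_le1 b.
have := p_ge0 a; have := p_ge0 b.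
move: (\sum_(y <- _) _) => V; move: (p a) (p b) => u v v0 u0 v1 u1 hb ha.
have h1 : u * v * (Y a - M) ^+ 2 <= V.
  by rewrite (le_trans _ ha)// ler_wpM2r ?sqr_ge0// ler_piMr.
have h2 : u * v * (Y b - M) ^+ 2 <= V.
  by rewrite (le_trans _ hb)// ler_wpM2r ?sqr_ge0// ler_piMl.
have h3 : 0 <= u * v * ((Y a - M) + (Y b - M)) ^+ 2.
  by rewrite mulr_ge0 ?sqr_ge0// mulr_ge0.
by lra.
Qed.

Let energy k := sqint Lam (fun s : S => A k (fun z => s (0%N, z)) 0).

(** [jensen_gap] for $Y=A^k\xi$, integrated; by translation invariance of the noise the second
    moment at each point [y] is [energy k]. *)
Lemma energy_decrement k a b :
  (energy k.+1 + (p a * p b / 4)%:E * gradvar k a b <= energy k)%E.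
Proof.
have m2 (F : S -> R) : centred Lam F -> measurable_fun setT (fun s => (F s ^+ 2)%:E).
  by move=> [mF _ _ _]; apply/measurable_EFinP; exact: measurable_funX.
have pp0 : 0 <= p a * p b / 4 by rewrite !mulr_ge0.
have -> : energy k = (\int[Lam]_s \sum_(y <- supp p)
    ((p y)%:E * ((A k (fun z => s (0%N, z)) y) ^+ 2)%:E))%E.
  rewrite ge0_integral_sum//; last 2 first.
  - by move=> y; apply: measurable_funeM; apply: m2; exact: centred_avg.
  - by move=> y s _; rewrite -EFinM lee_fin mulr_ge0 ?sqr_ge0.
  rewrite (eq_bigr (fun y => (p y)%:E * energy k)%E); last first.
    move=> y _; rewrite ge0_integralZl_EFin//; last 2 first.
    - by move=> s _; rewrite lee_fin sqr_ge0.
    - by apply: m2; exact: centred_avg.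
    by congr (_ * _)%E; exact: sqint_avg_shift.
  rewrite -ge0_sume_distrl; last by move=> y _; rewrite lee_fin.
  by rewrite sumEFin (sum_supp p_sum1) mul1e.
rewrite /gradvar /sqint -ge0_integralZl_EFin//; last 2 first.
- by move=> s _; rewrite lee_fin sqr_ge0.
- by apply: m2; exact: centred_avgB.
rewrite -ge0_integralD//; last 4 first.
- by move=> s _; rewrite lee_fin sqr_ge0.
- by apply: m2; exact: centred_avg.
- by move=> s _; rewrite -EFinM lee_fin mulr_ge0 ?sqr_ge0.
- by apply: measurable_funeM; apply: m2; exact: centred_avgB.
apply: ge0_le_integral => //.
- by move=> s _; rewrite -EFinM -EFinD lee_fin addr_ge0 ?sqr_ge0// mulr_ge0 ?sqr_ge0.
- apply: emeasurable_funD; first by apply: m2; exact: centred_avg.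
  by apply: measurable_funeM; apply: m2; exact: centred_avgB.
- apply: emeasurable_sum => y; apply: measurable_funeM; apply: m2; exact: centred_avg.
move=> s _; under [leRHS]eq_bigr do rewrite -EFinM.
rewrite sumEFin -EFinM -EFinD lee_fin iterS /avg.
under eq_bigr do rewrite add0r.
exact: jensen_gap.
Qed.

Lemma sum_gradvar_supp a b n : a \in supp p -> b \in supp p ->
  (\sum_(0 <= k < n) gradvar k a b <= (p a * p b / 4)^-1%:E * energy 0)%E.
Proof.
move=> asupp bsupp.
have pp0 : 0 < p a * p b / 4.
  by rewrite !mulr_gt0// lt_neqAle p_ge0 eq_sym andbT -(mem_supp p_sum1).
rewrite lee_pdivlMl//.
have H : (energy n + (p a * p b / 4)%:E * \sum_(0 <= k < n) gradvar k a b <= energy 0)%E.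
  elim: n => [|n ihn]; first by rewrite big_geq// mule0 adde0.
  rewrite big_nat_recr//= ge0_muleDr ?gradvar_ge0//; last first.
    by apply: sume_ge0 => k _; exact: gradvar_ge0.
  by rewrite addeCA (le_trans _ ihn)// addeC leeD2r// energy_decrement.
by rewrite (le_trans _ H)// leeDr// sqint_ge0.
Qed.

Lemma sum_gradvar_bounded x y :
  exists C : R, forall n, (\sum_(0 <= k < n) gradvar k x y <= C%:E)%E.
Proof.
pose G := [set w | exists C : R, forall n, (\sum_(0 <= k < n) gradvar k w 0%R <= C%:E)%E].
suff : G = setT.
  move=> GT; have [C HC] : G (x - y) by rewrite GT.
  exists C => n; apply: le_trans (HC n).
  by apply: lee_sum => k _; rewrite -(gradvar_shift k y (x - y) 0) subrK add0r.
have [b bsupp] : exists b, b \in supp p.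
  apply: contrapT => nb; have := sum_supp p_sum1; rewrite big_seq big1.
    by move=> /eqP; rewrite eq_sym oner_eq0.
  by move=> z zs; exfalso; apply: nb; exists z.
(* The shift by $-b$, with [b] in the support, makes the generators differences $a-b$ of support
   points, the case settled by [sum_gradvar_supp]. *)
apply: (aper (u := - b)).
  split.
    exists 0 => n; rewrite big1// => k _; rewrite /gradvar /sqint.
    by rewrite integral0_eq// => s _; rewrite subrr expr0n.
  move=> w w' [C HC] [C' HC']; exists (2 * C + 2 * C') => n.
  apply: (@le_trans _ _ (2%:E * (\sum_(0 <= k < n) gradvar k w 0%R) +
      2%:E * (\sum_(0 <= k < n) gradvar k w' 0%R))%E); last first.
    by rewrite (EFinD (2 * C)) (EFinM 2 C) (EFinM 2 C') leeD// lee_pmul2l.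
  rewrite !ge0_sume_distrr; [|by move=> ? _; exact: gradvar_ge0..].
  rewrite -big_split; apply: lee_sum => k _ /=.
  rewrite -(gradvar_shift k w' (w - w') 0) subrK add0r.
  rewrite (_ : gradvar k w w' = sqint Lam (fun s : S =>
    (A k (fun z => s (0%N, z)) w - A k (fun z => s (0%N, z)) 0) -
    (A k (fun z => s (0%N, z)) w' - A k (fun z => s (0%N, z)) 0))).
    by apply: sqintB_le; case: (centred_avgB k 0 w 0); case: (centred_avgB k 0 w' 0).
  by congr sqint; apply/funext => s; ring.
move=> a pa.
have asupp : a \in supp p by rewrite (mem_supp p_sum1) gt_eqF.
have [_ _ _ h] := centred_avg 0 0 0.
exists (fine ((p a * p b / 4)^-1%:E * energy 0)%E) => n.
rewrite fineK; last first.
  by rewrite fin_numM// ge0_fin_numE// sqint_ge0.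
apply: le_trans (sum_gradvar_supp n asupp bsupp).
apply: lee_sum => k _.
by rewrite -(gradvar_shift k b (- b + a) 0) add0r addrAC addNr add0r.
Qed.

End noise.

(** * Convergence of the noise series *)

Section noise_series.
Variables (R : realType) (d : nat) (p : Zd d -> R).
Hypothesis p_ge0 : forall x, 0 <= p x.
Hypothesis p_sum1 : \sum_(x \in [set: Zd d]) p x = 1.
Hypothesis aper : strongly_aperiodic p.
Variable m : set R -> \bar R.
Local Notation S := (prodR (nat * Zd d)%type R).
Variable Lam : probability S R.
Hypothesis iid : iid_field m Lam id.
Hypothesis centred_coord : forall j, centred Lam (fun s : S => s j).
Local Notation A k f x := (iter k (avg p) f x).
Variables x y : Zd d.

(** For [r = 0] this is the $k$-th term of the noise series; [r] counts further averagings applied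
    to the whole sum. *)
Definition noise_grad (r k : nat) (s : S) : R :=
  A (r + k) (fun z => s (k, z)) x - A (r + k) (fun z => s (k, z)) y.

Definition noise_psum (n : nat) (s : S) : R := \sum_(0 <= k < n) noise_grad 0 k s.

Let c k := fine (gradvar p Lam k x y).

Let c0 k : 0 <= c k.
Proof. by rewrite fine_ge0// gradvar_ge0. Qed.

Let cE k : (c k)%:E = gradvar p Lam k x y.
Proof. by rewrite fineK// (gradvar_fin p centred_coord). Qed.

Let centred_grad r k : centred Lam (noise_grad r k).
Proof. exact: centred_avgB. Qed.

Let mgrad r k : measurable_fun setT (noise_grad r k).
Proof. by have [] := centred_grad r k. Qed.

Let layer_grad r k s s' :
  (forall z, s (k, z) = s' (k, z)) -> noise_grad r k s = noise_grad r k s'.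
Proof. by move=> ss'; rewrite /noise_grad; congr (_ - _); apply: eq_iter_avg. Qed.

Let igrad r k : Lam.-integrable setT (EFin \o noise_grad r k).
Proof. by have [] := centred_grad r k. Qed.

Let grad0 r k : (\int[Lam]_s (noise_grad r k s)%:E = 0)%E.
Proof. by have [] := centred_grad r k. Qed.

Let grad2 r k : (sqint Lam (noise_grad r k) <= (c (r + k)%N)%:E)%E.
Proof. by rewrite cE -(gradvar_layer p iid centred_coord _ k). Qed.

Let sqint_sum r a n : (sqint Lam (fun s => \sum_(a <= k < n) noise_grad r k s)%R <=
  (\sum_(a <= k < n) c (r + k)%N)%R%:E)%E.
Proof.
exact: (sqint_independent_sum iid (mgrad r) (@layer_grad r) (igrad r) (grad0 r) (grad2 r)).
Qed.

Let c_summable : exists C : R, forall n, \sum_(0 <= k < n) c k <= C.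
Proof.
have [C HC] := sum_gradvar_bounded p_ge0 p_sum1 aper iid centred_coord x y.
exists C => n; rewrite -lee_fin -sumEFin (le_trans _ (HC n))//.
by apply: lee_sum => k _; rewrite cE.
Qed.

(** A single threshold on $r+a$ serves two purposes: the tail of the series ($r=0$) and the full sum
    after many averagings ($a=0$). Both have variance bounded by a tail of [c]. *)
Let absint_small e : 0 < e -> exists N, forall r a n, (N <= r + a)%N ->
  (absint Lam (fun s => \sum_(a <= k < n) noise_grad r k s)%R <= e%:E)%E.
Proof.
move=> e0; have [C HC] := c_summable.
have e2 : 0 < e / 2 by rewrite divr_gt0.
(* Tail variance at most $(e/2)^2$, so that [absint_le_sqint] at level $e/2$ returns $e/2+e/2$. *)
have [N HN] := summable_tail c0 HC (exprn_gt0 2 e2).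
exists N => r a n Nra.
have ms : measurable_fun setT (fun s => \sum_(a <= k < n) noise_grad r k s).
  exact: measurable_sum.
apply: (le_trans (absint_le_sqint Lam ms e2)).
have [na|an] := leqP n a.
  rewrite /sqint integral0_eq ?mule0 ?adde0 ?lee_fin.
    by rewrite ler_pdivrMr// mulr2n mulrDr mulr1 lerDl ltW.
  by move=> s _; rewrite big_geq// expr0n.
rewrite [leRHS](_ : _ = (e / 2)%:E + ((e / 2)^-1)%:E * ((e / 2) ^+ 2)%:E)%E; last first.
  by rewrite -EFinM -EFinD expr2 mulKf ?gt_eqF// -splitr.
rewrite leeD2l// lee_wpmul2l//; first by rewrite lee_fin invr_ge0 ltW.
apply: (le_trans (sqint_sum _ _ _)); rewrite lee_fin.
apply: le_trans (HN (r + n)%N).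
rewrite (big_cat_nat Nra) ?leq_add2l 1?ltnW//=.
rewrite -[X in _ <= _ + X]/(\sum_(r + a <= k < r + n) c k).
rewrite (addnC r a) (addnC r n) big_addn addnK.
rewrite (eq_bigr (fun k => c (k + r)%N)); last by move=> k _; rewrite addnC.
by rewrite lerDr sumr_ge0.
Qed.

Lemma measurable_noise_psum n : measurable_fun setT (noise_psum n).
Proof. exact: measurable_sum. Qed.

Lemma noise_psum_cvgn : {ae Lam, forall s, cvgn (fun n => noise_psum n s)}.
Proof.
have [C HC] := c_summable.
exact: (independent_series_cvgn iid (mgrad 0) (@layer_grad 0) (igrad 0)
  (grad0 0) (grad2 0) c0 HC).
Qed.

Lemma noise_psum_absint_lim e : 0 < e -> exists N, forall n, (N <= n)%N ->
  (absint Lam (fun s => limn (fun n => noise_psum n s) - noise_psum n s)%R <= e%:E)%E.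
Proof.
move=> e0; have [N HN] := absint_small e0; exists N => n Nn.
apply: absint_lim => //.
- exact: measurable_noise_psum.
- exact: noise_psum_cvgn.
move=> k nk; rewrite (_ : (fun s => _) = (fun s => \sum_(n <= i < k) noise_grad 0 i s)).
  exact: HN.
apply/funext => s; rewrite /noise_psum (big_cat_nat (leq0n n) nk)/=.
by rewrite addrC addrK.
Qed.

Lemma noise_tail_small e : 0 < e -> exists N, forall r n, (N <= r)%N ->
  (absint Lam (fun s => \sum_(0 <= k < n) noise_grad r k s)%R <= e%:E)%E.
Proof.
move=> e0; have [N HN] := absint_small e0; exists N => r n Nr.
by apply: HN; rewrite addn0.
Qed.

End noise_series.

(** * Iterating the chain *)

Section measure_preserving.
Context d d' (T : measurableType d) (U : measurableType d') (R : realType).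
Variables (mu : probability T R) (nu : probability U R) (Y : T -> U).

Definition preserves : Prop :=
  measurable_fun setT Y /\ forall A, measurable A -> mu (Y @^-1` A) = nu A.

Hypothesis pY : preserves.
Local Open Scope ereal_scope.

Lemma preserves_ge0_integral (F : U -> \bar R) :
  measurable_fun setT F -> (forall u, 0 <= F u) ->
  \int[mu]_t F (Y t) = \int[nu]_u F u.
Proof.
move=> mF F0; rewrite -(ge0_integral_law mu pY.1 mF F0).
by apply: eq_measure_integral => A mA _; exact: pY.2.
Qed.

Lemma preserves_absint (f : U -> R) : measurable_fun setT f ->
  absint mu (fun t => f (Y t)) = absint nu f.
Proof.
move=> mf; apply: (preserves_ge0_integral (F := fun u => (`|f u|%R)%:E)) => //.
by apply/measurable_EFinP; exact: measurableT_comp.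
Qed.

Lemma preserves_integrable (f : U -> \bar R) : nu.-integrable setT f ->
  mu.-integrable setT (fun t => f (Y t)).
Proof.
move=> /integrableP[mf f1]; apply/integrableP; split.
  exact: (measurableT_comp mf pY.1).
rewrite (preserves_ge0_integral (F := fun u => `|f u|))//.
exact: measurableT_comp.
Qed.

Lemma preserves_integral (f : U -> \bar R) : nu.-integrable setT f ->
  \int[mu]_t f (Y t) = \int[nu]_u f u.
Proof.
move=> jf; have jfY := preserves_integrable jf.
rewrite -(integral_law pY.1)//; last by case/integrableP: jf.
by apply: eq_measure_integral => A mA _; exact: pY.2.
Qed.

End measure_preserving.

Section product_projections.
Context d d' (T : measurableType d) (U : measurableType d') (R : realType).
Variables (mu : probability T R) (nu : probability U R).
Local Open Scope ereal_scope.

Lemma preserves_fst : preserves (mu \x nu) mu fst.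
Proof.
split; first exact: measurable_fst.
move=> A mA; rewrite (_ : fst @^-1` A = A `*` setT).
  transitivity (mu A * nu setT); first exact: product_measure1E.
  by rewrite (probability_setT nu) mule1.
by apply/seteqP; split=> -[t u] //= [].
Qed.

Lemma preserves_snd : preserves (mu \x nu) nu snd.
Proof.
split; first exact: measurable_snd.
move=> A mA; rewrite (_ : snd @^-1` A = setT `*` A).
  transitivity (mu setT * nu A); first exact: product_measure1E.
  by rewrite (probability_setT mu) mul1e.
by apply/seteqP; split=> -[t u] //= [].
Qed.

End product_projections.

Section chain.
Variables (R : realType) (d : nat) (p : Zd d -> R).
Hypothesis p_sum1 : \sum_(x \in [set: Zd d]) p x = 1.
Variable m : set R -> \bar R.
Local Notation S := (prodR (nat * Zd d)%type R).
Local Notation conf := (conf R d).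
Variable Lam : probability S R.
Hypothesis iid : iid_field m Lam id.
Local Notation A k f x := (iter k (avg p) f x).
Variable nu : probability conf R.
Hypothesis inv : forall l E, measurable E ->
  (\int[nu]_eta Lam ((fun s : S => step p eta (fun x => s (l, x))) @^-1` E) = nu E)%E.

(** The configuration after [t] steps, with noise labelled by age: the newest is layer 0 and the
    oldest layer [t - 1]. *)
Definition evolve (t : nat) (z : conf * S) : conf :=
  fun j => A t (fun x => z.1 (x, j.2)) j.1 +
           noise_psum p j.1 (j.1 - e_ j.2) t z.2.

Lemma stepE eta (f : Zd d -> R) j :
  step p eta f j = A 1 (fun x => eta (x, j.2)) j.1 + f j.1 - f (j.1 - e_ j.2).
Proof. by rewrite /step (fsum_kernel p_sum1). Qed.

Lemma measurable_iter_avg d0 (T : measurableType d0) k (f : T -> Zd d -> R) x :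
  (forall z, measurable_fun setT (fun t => f t z)) ->
  measurable_fun setT (fun t => A k (f t) x).
Proof.
move=> mf; rewrite (_ : (fun t => _) =
  (fun t => \sum_(q <- paths p (fun=> 0) k) q.1.1 * f t (x + q.1.2))).
  by apply: measurable_sum => q; exact: measurable_funM.
by apply/funext => t; rewrite (iter_avgE _ (fun=> 0)).
Qed.

Lemma measurable_noise_grad x y r k :
  measurable_fun setT (fun s : S => noise_grad p x y r k s).
Proof.
by apply: measurable_funB; apply: measurable_iter_avg => z; exact: measurable_coord.
Qed.

Lemma measurable_evolve t : measurable_fun setT (evolve t).
Proof.
apply: measurable_fun_prodR => j; apply: measurable_funD.
  apply: measurable_iter_avg => z.
  exact: (measurableT_comp (measurable_coord _) measurable_fst).
apply: measurable_sum => k.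
exact: (measurableT_comp (measurable_noise_grad _ _ _ _) measurable_snd).
Qed.

Lemma measurable_step l :
  measurable_fun setT (fun z : conf * S => step p z.1 (fun x => z.2 (l, x))).
Proof.
apply: measurable_fun_prodR => j.
under eq_fun do rewrite stepE.
have mz z : measurable_fun setT (fun t : conf * S => t.2 (l, z)).
  exact: (measurableT_comp (measurable_coord _) measurable_snd).
apply: measurable_funB => //; apply: measurable_funD => //.
apply: measurable_iter_avg => z.
exact: (measurableT_comp (measurable_coord _) measurable_fst).
Qed.

Lemma preserves_step l :
  preserves (nu \x Lam)%E nu (fun z => step p z.1 (fun x => z.2 (l, x))).
Proof.
split; first exact: measurable_step.
move=> E mE; rewrite -[RHS](inv l mE); apply: eq_integral => eta _ /=.
congr (Lam _); apply/seteqP; split => s /=; rewrite /xsection/= inE//.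
Qed.

Local Open Scope ereal_scope.

(** The earliest of the $t+1$ steps uses the oldest layer [t]. Below it only agreement of [s] and
    [s'] is required, which allows layer [t] to be resampled. *)
Lemma evolveS t eta s s' : (forall k z, (k < t)%N -> s' (k, z) = s (k, z)) ->
  evolve t.+1 (eta, s') = evolve t (step p eta (fun x => s' (t, x)), s).
Proof.
move=> ss'; apply/funext => j; rewrite /evolve/= /noise_psum big_nat_recr//=.
rewrite (eq_big_nat _ _ (F2 := fun k => noise_grad p j.1 (j.1 - e_ j.2)%R 0 k s)); last first.
  move=> k /andP[_ kt]; rewrite /noise_grad.
  by congr (_ - _)%R; apply: eq_iter_avg => z; exact: ss'.
rewrite (eq_iter_avg _ _ _ (g := fun x => A 1 (fun x => eta (x, j.2)) x +
  (s' (t, x) - s' (t, x - e_ j.2)))%R); last first.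
  by move=> x; rewrite stepE addrA.
rewrite iter_avgD iter_avgB (iter_avg_shift p t (fun x => s' (t, x))) -iterD addn1 /noise_grad add0n.
by rewrite -[RHS]addrA; congr (_ + _)%R; rewrite addrC.
Qed.

(** Layer [t] is redrawn as [s2], so the earliest step uses noise independent of the rest; with [s1]
    fixed, invariance absorbs this step and the induction hypothesis handles the other [t]. *)
Lemma evolve_ge0_integral t (F : conf -> \bar R) :
  measurable_fun setT F -> (forall eta, 0 <= F eta) ->
  \int[nu]_eta \int[Lam]_s F (evolve t (eta, s)) = \int[nu]_eta F eta.
Proof.
elim: t F => [|t iht] F mF F0.
  apply: eq_integral => eta _; rewrite -[RHS](integral_prob_cst Lam).
  apply: eq_integral => s _; congr F; apply/funext => j.
  by rewrite /evolve/= /noise_psum big_geq// addr0; case: j.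
pose b : pred (nat * Zd d) := fun j => j.1 != t.
pose mix (t : S * S) : S := fun j => if b j then t.1 j else t.2 j.
have imix : iid_field m (Lam \x Lam) mix by exact: (iid_field_mix b iid iid).
pose H (z : (conf * S) * S) := F (evolve t (step p z.1.1 (fun x => z.2 (t, x)), z.1.2)).
have mH : measurable_fun setT H.
  apply: (measurableT_comp mF); apply: (measurableT_comp (measurable_evolve t)).
  apply: measurable_fun_pair; last first.
    exact: (measurableT_comp measurable_snd measurable_fst).
  apply: (measurableT_comp (measurable_step t)
    (g := fun z : (conf * S) * S => (z.1.1, z.2))).
  apply: measurable_fun_pair => //.
  exact: (measurableT_comp measurable_fst measurable_fst).
have H0 z : 0 <= H z by exact: F0.
transitivity (\int[nu]_eta \int[Lam]_s1 \int[Lam]_s2 H ((eta, s1), s2)).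
  apply: eq_integral => eta _.
  have mFe : measurable_fun setT (fun s => F (evolve t.+1 (eta, s))).
    apply: (measurableT_comp mF); apply: (measurableT_comp (measurable_evolve t.+1)).
    exact: measurable_fun_pair.
  rewrite (iid_field_ge0_integral iid imix mFe)//.
  rewrite (fubini_tonelli1 (fun z => F (evolve t.+1 (eta, mix z))))//; last first.
    exact: (measurableT_comp mFe imix.1).
  apply: eq_integral => s1 _; apply: eq_integral => s2 _.
  rewrite /H/=; congr F; rewrite (@evolveS _ _ s1).
    by congr (evolve _ (step _ _ _, _)); apply/funext => x; rewrite /mix /b/= eqxx.
  by move=> k z kt; rewrite /mix /b/= (ltn_eqF kt).
rewrite (fubini_tonelli (m1 := nu) (m2 := Lam)
  (fun z => \int[Lam]_s2 H (z, s2)))/=; last 2 first.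
- by apply: (measurable_fun_fubini_tonelli_F (m2 := Lam) H).
- by move=> z; apply: integral_ge0.
transitivity (\int[Lam]_s1 \int[nu]_eta F (evolve t (eta, s1))).
  apply: eq_integral => s1 _.
  have mFs : measurable_fun setT (fun eta => F (evolve t (eta, s1))).
    apply: (measurableT_comp mF); apply: (measurableT_comp (measurable_evolve t)).
    exact: measurable_fun_pair.
  rewrite -(preserves_ge0_integral (preserves_step t) mFs)//.
  rewrite (fubini_tonelli1 (fun z : conf * S =>
    F (evolve t (step p z.1 (fun x => z.2 (t, x)), s1))))//.
  exact: (measurableT_comp mFs (measurable_step t)).
rewrite -(fubini_tonelli (m1 := nu) (m2 := Lam) (fun z => F (evolve t z)))//.
  exact: iht.
exact: (measurableT_comp mF (measurable_evolve t)).
Qed.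

Lemma preserves_evolve t : preserves (nu \x Lam) nu (evolve t).
Proof.
split; first exact: measurable_evolve.
move=> E mE.
have mI : measurable_fun setT (fun eta : conf => (\1_E eta)%:E : \bar R).
  by apply/measurable_EFinP; exact: measurable_indic.
have := @evolve_ge0_integral t _ mI (fun eta => _).
rewrite integral_indic// setIT => <-.
  apply: eq_integral => eta _ /=.
  rewrite -[LHS]/(Lam (xsection (evolve t @^-1` E) eta)).
  rewrite -[in LHS](setIT (xsection _ _)) -integral_indic//; last first.
    apply: measurable_xsection; rewrite -[X in measurable X]setTI.
    exact: measurable_evolve.
  apply: eq_integral => s _; congr EFin; rewrite !indicE.
  by rewrite mem_xsection.
by move=> eta; rewrite lee_fin.
Qed.

End chain.

(** * Decay of the gradient *)

Section gradient_decay.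
Context d0 (T : measurableType d0).
Variables (R : realType) (d : nat) (p : Zd d -> R) (nu : probability T R).
Hypothesis p_ge0 : forall x, 0 <= p x.
Hypothesis p_sum1 : \sum_(x \in [set: Zd d]) p x = 1.
Hypothesis aper : strongly_aperiodic p.
Local Notation A k f x := (iter k (avg p) f x).
Variable f : Zd d -> T -> R.
Hypothesis mf : forall x, measurable_fun setT (f x).

Definition subdiffusive : Prop := forall eps, 0 < eps -> exists r0 : R,
  forall r x, r0 <= r -> znorm R x <= r ->
    (absint nu (f x) <= (eps * Num.sqrt r)%:E)%E.

Hypothesis f_growth : subdiffusive.

Let G t x y : \bar R := absint nu (fun w => A t (f^~ w) x - A t (f^~ w) y).

Let mA t x : measurable_fun setT (fun w => A t (f^~ w) x).
Proof. by apply: measurable_iter_avg. Qed.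

Let grad_triangle t x y z : (G t x y <= G t x z + G t y z)%E.
Proof. exact: absintB. Qed.

Let decay_support a b x (e : R) : a \in supp p -> b \in supp p -> 0 < e ->
  exists N, forall t, (N <= t)%N -> (G t (x + a)%R (x + b)%R <= e%:E)%E.
Proof.
move=> asupp bsupp e0.
set V := \sum_(y <- supp p) p y * score p a b y ^+ 2.
have V0 : 0 <= V by apply: sumr_ge0 => y _; rewrite mulr_ge0 ?sqr_ge0.
set K := l1norm R x + \sum_(y <- supp p) l1norm R y + 1.
have K0 : 0 < K.
  by rewrite ltr_wpDl// addr_ge0 ?l1norm_ge0// sumr_ge0// => y _; exact: l1norm_ge0.
have sK : 0 < Num.sqrt K by rewrite sqrtr_gt0.
have V1 : 0 < 1 + V by rewrite ltr_wpDr.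
pose eps := e / (Num.sqrt K * (1 + V)).
have eps0 : 0 < eps by rewrite divr_gt0// mulr_gt0.
have [r0 Hr0] := f_growth eps0.
exists (Num.truncn (`|r0| / K)) => t Nt.
have r0K : r0 <= K * t.+1%:R.
  rewrite (le_trans (ler_norm r0))// -ler_pdivrMl// mulrC.
  by rewrite (le_trans (ltW (truncnS_gt _)))// ler_nat.
pose P := paths p (score p a b) t.+1.
have HP q : q \in P -> (absint nu (f (x + q.1.2)%R) <=
    (eps * Num.sqrt (K * t.+1%:R))%:E)%E.
  move=> qP; apply: Hr0 => //; apply: (le_trans (znorm_le_l1norm _ _)).
  apply: (le_trans (l1normD _ _ _)); rewrite /K !mulrDl mul1r.
  apply: (@le_trans _ _ (l1norm R x * t.+1%:R +
     (\sum_(y <- supp p) l1norm R y) * t.+1%:R)); last by rewrite lerDl.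
  rewrite lerD//; first by rewrite ler_peMr ?l1norm_ge0// ler1n.
  by rewrite mulrC; exact: path_l1norm qP.
have E w : t.+1%:R * (A t (f^~ w) (x + a) - A t (f^~ w) (x + b)) =
    \sum_(q <- P) (q.1.1 * q.2) * f (x + q.1.2) w.
  rewrite (sum_path_score p_sum1 t.+1 (f^~ w) x asupp bsupp)/= iter_avgB.
  by rewrite !(iter_avg_shift p t (f^~ w)).
have t0 : 0 < t.+1%:R :> R by [].
rewrite -(@lee_pmul2l _ t.+1%:R%:E)//.
have -> : (t.+1%:R%:E * G t (x + a)%R (x + b)%R =
    absint nu (fun w => \sum_(q <- P) (q.1.1 * q.2) * f (x + q.1.2) w)%R)%E.
  rewrite -ge0_integralZl_EFin//; last first.
    apply/measurable_EFinP; apply: measurableT_comp => //.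
    exact: measurable_funB.
  apply: eq_integral => w _; rewrite -EFinM -E normrM.
  by rewrite [in RHS]ger0_norm.
apply: (le_trans (absint_sum nu P (fun q => q.1.1 * q.2) (fun q => mf (x + q.1.2)))).
apply: (@le_trans _ _ (\sum_(q <- P)
    (q.1.1 * `|q.2| * (eps * Num.sqrt (K * t.+1%:R)))%:E)).
  rewrite big_seq [leRHS]big_seq; apply: lee_sum => q qP.
  rewrite normrM (ger0_norm (path_weight_ge0 p_ge0 qP)) [leRHS]EFinM.
  rewrite lee_wpmul2l ?HP// lee_fin mulr_ge0// (path_weight_ge0 p_ge0 qP)//.
rewrite sumEFin -mulr_suml -EFinM lee_fin.
apply: (@le_trans _ _ (Num.sqrt t.+1%:R * (1 + V) * (eps * Num.sqrt (K * t.+1%:R)))).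
  rewrite ler_wpM2r//; first by rewrite mulr_ge0 ?sqrtr_ge0// ltW.
  by apply: sum_path_abs => //; exact: sum_score0.
rewrite sqrtrM; last exact: ltW.
rewrite /eps.
rewrite [leLHS](_ : _ = Num.sqrt t.+1%:R ^+ 2 * e); first by rewrite sqr_sqrtr// ltW.
by field; rewrite !gt_eqF.
Qed.

Lemma gradient_decay x y (e : R) : 0 < e -> exists N, forall t, (N <= t)%N ->
  (absint nu (fun w => A t (f^~ w) x - A t (f^~ w) y)%R <= e%:E)%E.
Proof.
pose D := [set w : Zd d | forall x (e : R), 0 < e ->
  exists N, forall t, (N <= t)%N -> (G t (x + w)%R x <= e%:E)%E].
suff : D = setT.
  move=> DT; have /(_ y e) : D (x - y) by rewrite DT.
  by rewrite addrC subrK.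
have [b bsupp] : exists b, b \in supp p.
  apply: contrapT => nb; have := sum_supp p_sum1; rewrite big_seq big1.
    by move=> /eqP; rewrite eq_sym oner_eq0.
  by move=> z zs; exfalso; apply: nb; exists z.
apply: (aper (u := - b)).
  split.
    move=> z e' e'0; exists 0%N => t _; rewrite addr0 /G /absint integral0_eq ?lee_fin ?ltW//.
    by move=> w _; rewrite subrr normr0.
  move=> w w' Dw Dw' z e' e'0.
  have e2 : 0 < e' / 2 by rewrite divr_gt0.
  have [N HN] := Dw (z - w') _ e2; have [N' HN'] := Dw' (z - w') _ e2.
  exists (maxn N N') => t; rewrite geq_max => /andP[Nt N't].
  apply: (le_trans (grad_triangle _ _ _ (z - w'))).
  rewrite (splitr e') EFinD leeD//.
    by have := HN t Nt; rewrite addrAC -addrA.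
  by have := HN' t N't; rewrite subrK.
move=> a pa z e' e'0.
have asupp : a \in supp p by rewrite (mem_supp p_sum1) gt_eqF.
have [N HN] := decay_support (z - b) asupp bsupp e'0.
by exists N => t /HN; rewrite subrK -addrA.
Qed.

End gradient_decay.

(** * Limits in mean of measure preserving maps *)

Section convergence_in_mean.
Context d (T : measurableType d) (R : realType) (mu : probability T R).
Local Open Scope ereal_scope.

Lemma markov_shift (f g : T -> R) (r e : R) : (0 < e)%R ->
  measurable_fun setT f -> measurable_fun setT g ->
  mu [set x | (f x <= r)%R] <= mu [set x | (g x <= r + e)%R] +
    (e^-1)%:E * absint mu (fun x => f x - g x)%R.
Proof.
move=> e0 mf mg.
have mle (h : T -> R) (a : R) : measurable_fun setT h ->
    measurable [set x | (h x <= a)%R].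
  move=> mh; rewrite -[X in measurable X]setTI.
  have := mh measurableT `]-oo, a]%classic (measurable_itv _).
  by congr (measurable (_ `&` _)); apply/seteqP; split => x; rewrite /= in_itv.
have ind (h : T -> R) (a : R) : measurable_fun setT h ->
    mu [set x | (h x <= a)%R] = \int[mu]_x (\1_[set x | (h x <= a)%R] x)%:E.
  by move=> mh; rewrite integral_indic ?setIT//; exact: mle.
rewrite !ind//.
have mabs : measurable_fun setT (fun x => (`|f x - g x|%R)%:E).
  by apply/measurable_EFinP; apply: measurableT_comp => //; exact: measurable_funB.
rewrite -ge0_integralZl_EFin//; last by rewrite invr_ge0 ltW.
rewrite -ge0_integralD//; last 3 first.
- by apply/measurable_EFinP; apply: measurable_indic; exact: mle.
- by move=> x _; rewrite -EFinM lee_fin mulr_ge0// invr_ge0 ltW.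
- exact: measurable_funeM.
apply: ge0_le_integral => //.
- by apply/measurable_EFinP; apply: measurable_indic; exact: mle.
- apply: emeasurable_funD; last exact: measurable_funeM.
  by apply/measurable_EFinP; apply: measurable_indic; exact: mle.
move=> x _; rewrite -EFinM -EFinD lee_fin !indicE.
have h0 : (0 <= e^-1 * `|f x - g x|)%R by rewrite mulr_ge0// invr_ge0 ltW.
case: (boolP (x \in [set x | (f x <= r)%R])) => fx; last by rewrite addr_ge0.
case: (boolP (x \in [set x | (g x <= r + e)%R])) => gx; first by rewrite lerDl.
rewrite add0r mulrC ler_pdivlMr// mul1r.
move: fx gx; rewrite inE notin_setE/= => fx /negP; rewrite -ltNge => gx.
by rewrite distrC (le_trans _ (ler_norm _))// lerBrDl (le_trans _ (ltW gx))// lerD2r.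
Qed.

Lemma le_measure_sublevel (f : T -> R) (a : \bar R) : measurable_fun setT f ->
  (forall e : R, (0 < e)%R -> a <= mu [set x | (f x <= e)%R]) ->
  a <= mu [set x | (f x <= 0)%R].
Proof.
move=> mf H.
pose F (n : nat) := [set x | (f x <= n.+1%:R^-1)%R].
have mF n : measurable (F n).
  rewrite -[X in measurable X]setTI.
  have := mf measurableT `]-oo, (n.+1%:R^-1)%R]%classic (measurable_itv _).
  by congr (measurable (_ `&` _)); apply/seteqP; split => x; rewrite /= in_itv.
have -> : [set x | (f x <= 0)%R] = \bigcap_n F n.
  apply/seteqP; split => x /=.
    by move=> fx n _; rewrite /F/= (le_trans fx).
  move=> Fx; apply/ler_addgt0Pr => e e0; rewrite add0r.
  apply: (le_trans (Fx (Num.truncn e^-1) I)).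
  by rewrite invf_ple ?posrE// ltW// truncnS_gt.
have cv := @nonincreasing_cvg_mu _ _ _ mu F _ mF (bigcapT_measurable mF).
have {}cv : mu \o F @ \oo --> mu (\bigcap_n F n).
  apply: cv; first by rewrite (le_lt_trans (probability_le1 _ _))// ltry.
  move=> n n' nn'; apply/subsetPset => x /= h; rewrite /F/= (le_trans h)//.
  by rewrite lef_pV2 ?posrE// ler_nat.
rewrite -(cvg_lim _ cv)//; apply: lime_ge; first by apply/cvg_ex; eexists; exact: cv.
by apply: nearW => n /=; apply: H; rewrite invr_gt0.
Qed.

End convergence_in_mean.

Section law_of_limit.
Variables (I : choiceType) (R : realType).
Context d (T : measurableType d) (mu : probability T R).
Variables (nu : probability (prodR I R) R).
Variables (Y : nat -> T -> prodR I R) (Z : T -> prodR I R).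
Hypothesis pY : forall n, preserves mu nu (Y n).
Hypothesis mZ : measurable_fun setT Z.
Hypothesis YZ : forall i (e : R), 0 < e -> exists N, forall n, (N <= n)%N ->
  (absint mu (fun t => Y n t i - Z t i)%R <= e%:E)%E.

Let defect (s : seq (I * R)) (f : prodR I R) : R :=
  \sum_(q <- s) Num.max 0 (q.2 - f q.1).

Let measurable_defect s : measurable_fun setT (defect s).
Proof.
apply: measurable_sum => q; apply: measurable_maxr => //.
by apply: measurable_funB => //; exact: measurable_coord.
Qed.

Let boxE s : [set f | all (fun q => q.2 <= f q.1) s] = [set f | defect s f <= 0].
Proof.
apply/seteqP; split => f /=.
  move=> /allP H; rewrite /defect big_seq big1// => q qs.
  by apply/max_idPl; rewrite subr_le0 H.
elim: s => [//|q s ihs]; rewrite /defect big_cons => H.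
have h1 : 0 <= Num.max 0 (q.2 - f q.1) by rewrite le_max lexx.
have h2 : 0 <= \sum_(q <- s) Num.max 0 (q.2 - f q.1).
  by apply: sumr_ge0 => q' _; rewrite le_max lexx.
apply/andP; split; last by apply: ihs; rewrite /defect; lra.
have : Num.max 0 (q.2 - f q.1) <= 0 by lra.
by rewrite ge_max lexx/= subr_le0.
Qed.

Let defect_lip s f g :
  `|defect s f - defect s g| <= \sum_(q <- s) `|f q.1 - g q.1|.
Proof.
rewrite /defect -sumrB (le_trans (ler_norm_sum _ _ _))//.
apply: ler_sum => q _; move: (f q.1) (g q.1) => u v.
by rewrite /Num.max; case: ifP => [|/negbT]; case: ifP => [|/negbT];
  rewrite -?leNgt => h1 h2; rewrite ler_norml;
  case: (ler0P (u - v)) => h; apply/andP; split; lra.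
Qed.

Let defect_cvg s (e : R) : 0 < e -> exists n,
  (absint mu (fun t => defect s (Y n t) - defect s (Z t))%R <= e%:E)%E.
Proof.
have mY n : measurable_fun setT (Y n) by case: (pY n).
have mi n q : measurable_fun setT (fun t => Y n t q - Z t q).
  by apply: measurable_funB; exact: (measurableT_comp (measurable_coord _)).
suff H : forall e : R, 0 < e -> exists N, forall n, (N <= n)%N ->
   (\sum_(q <- s) absint mu (fun t => Y n t q.1 - Z t q.1)%R <= e%:E)%E.
  move=> /H[n /(_ n (leqnn n)) Hn]; exists n; apply: le_trans Hn.
  have mabs q : measurable_fun setT (fun t => (`|Y n t q - Z t q|)%:E).
    by apply/measurable_EFinP; exact: measurableT_comp.
  rewrite /absint -ge0_integral_sum//.
  apply: ge0_le_integral => //.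
  - apply/measurable_EFinP; apply: measurableT_comp => //.
    by apply: measurable_funB; exact: (measurableT_comp (measurable_defect s)).
  - by apply: emeasurable_sum => q; exact: mabs.
  by move=> t _; rewrite sumEFin lee_fin defect_lip.
elim: s => [|q s ihs] {}e e0.
  by exists 0%N => n _; rewrite big_nil lee_fin ltW.
have e2 : 0 < e / 2 by rewrite divr_gt0.
have [N HN] := ihs _ e2; have [N' HN'] := YZ q.1 e2.
exists (maxn N N') => n; rewrite geq_max => /andP[Nn N'n].
by rewrite big_cons (splitr e) EFinD leeD// ?HN' ?HN.
Qed.

Lemma preserves_limit : preserves mu nu Z.
Proof.
split=> // A mA; rewrite -[LHS]/(law mu mZ A).
apply: (@prodR_measure_unique _ _ (law mu mZ) nu _ A mA) => s.
rewrite -[LHS]/(mu (Z @^-1` [set f | all (fun q => q.2 <= f q.1) s])) boxE.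
have mD n : measurable_fun setT (fun t => defect s (Y n t)).
  by apply: (measurableT_comp (measurable_defect s)); case: (pY n).
have mDZ : measurable_fun setT (fun t => defect s (Z t)).
  exact: (measurableT_comp (measurable_defect s)).
have mle (a : R) : measurable [set f | defect s f <= a].
  rewrite -[X in measurable X]setTI.
  have := @measurable_defect s measurableT `]-oo, a]%classic (measurable_itv _).
  by congr (measurable (_ `&` _)); apply/seteqP; split => x; rewrite /= in_itv.
have EY n a : mu [set t | defect s (Y n t) <= a] = nu [set f | defect s f <= a].
  exact: ((pY n).2 _ (mle a)).
rewrite -[LHS]/(mu [set t | defect s (Z t) <= 0]).
have small (r : R) : 0 < r -> forall c : R, 0 < c -> exists n,
    ((r^-1)%:E * absint mu (fun t => defect s (Y n t) - defect s (Z t))%R <= c%:E)%E.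
  move=> r0 c c0; have [n Hn] := @defect_cvg s (r * c) (mulr_gt0 r0 c0).
  by exists n; rewrite lee_pdivrMl.
apply/eqP; rewrite eq_le; apply/andP; split.
  apply: le_measure_sublevel => // r r0; apply/lee_addgt0Pr => c c0.
  have [n Hn] := small r r0 c c0; rewrite -(EY n).
  apply: (le_trans (@markov_shift _ _ _ mu _ _ 0 r r0 mDZ (mD n))).
  by rewrite add0r absintN leeD2l.
apply: le_measure_sublevel => // r r0; apply/lee_addgt0Pr => c c0.
have [n Hn] := small r r0 c c0; rewrite -(EY n).
apply: (le_trans (@markov_shift _ _ _ mu _ _ 0 r r0 (mD n) mDZ)).
by rewrite add0r leeD2l.
Qed.

End law_of_limit.

(** * The limiting random shift *)

Section mixture.
Variables (R : realType) (d : nat) (p : Zd d -> R).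
Hypothesis p_ge0 : forall x, 0 <= p x.
Hypothesis p_sum1 : \sum_(x \in [set: Zd d]) p x = 1.
Hypothesis aper : strongly_aperiodic p.
Variable m : set R -> \bar R.
Local Notation S := (prodR (nat * Zd d)%type R).
Local Notation conf := (conf R d).
Variable Lam : probability S R.
Hypothesis iid : iid_field m Lam id.
Hypothesis centred_coord : forall j, centred Lam (fun s : S => s j).
Local Notation A k f x := (iter k (avg p) f x).
Variable nu : probability conf R.
Hypothesis inv : forall l E, measurable E ->
  (\int[nu]_eta Lam ((fun s : S => step p eta (fun x => s (l, x))) @^-1` E) = nu E)%E.
Variable v : Zd d * 'I_d -> R.
Hypothesis v_harmonic : forall x i, A 1 (fun z => v (z, i)) x = v (x, i).
Hypothesis v_growth : forall i,
  subdiffusive nu (fun x (eta : conf) => eta (x, i) - v (x, i)).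

Definition deviation (t : nat) (x : Zd d) (i : 'I_d) (eta : conf) : R :=
  A t (fun z => eta (z, i) - v (z, i)) x.

Let measurable_dev1 i z : measurable_fun setT (fun eta : conf => eta (z, i) - v (z, i)).
Proof. by apply: measurable_funB => //; exact: measurable_coord. Qed.

Lemma measurable_deviation t x i : measurable_fun setT (deviation t x i).
Proof. by apply: measurable_iter_avg => z; exact: measurable_dev1. Qed.

Lemma iter_harmonic t x i : A t (fun z => v (z, i)) x = v (x, i).
Proof.
elim: t x => [//|t iht] x; rewrite iterS -v_harmonic /=.
by congr avg; apply/funext => z; rewrite iht.
Qed.

Lemma deviation_evolve s t x i z :
  deviation s x i (evolve p t z) =
  deviation (s + t) x i z.1 + \sum_(0 <= k < t) noise_grad p x (x - e_ i) s k z.2.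
Proof.
rewrite /deviation !iter_avgB !iter_harmonic /evolve/= iter_avgD -iterD.
rewrite /noise_psum iter_avg_sum -!addrA; congr (_ + _); rewrite addrC; congr (_ + _).
apply: eq_bigr => k _; rewrite /noise_grad iter_avgB add0n !iterD.
by rewrite (iter_avg_shift p s (iter k (avg p) (fun z0 => z.2 (k, z0)))).
Qed.

Lemma deviation_step_small s x i e : 0 < e -> exists N, forall t, (N <= t)%N ->
  (absint nu (fun eta => deviation (s + t) x i eta - deviation t x i eta)%R <= e%:E)%E.
Proof.
move=> e0; pose P := paths p (fun=> 0) s.
have [N HN] : exists N, forall t, (N <= t)%N -> forall q, q \in P ->
    (absint nu (fun eta => deviation t (x + q.1.2)%R i eta - deviation t x i eta)%R
       <= e%:E)%E.
  elim: P => [|q P [N HN]]; first by exists 0%N.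
  have [N' HN'] := gradient_decay p_ge0 p_sum1 aper (measurable_dev1 i) (v_growth i)
    (x + q.1.2) x e0.
  exists (maxn N N') => t; rewrite geq_max => /andP[Nt N't] q'.
  by rewrite inE => /predU1P[->|]; [exact: HN'|exact: HN].
exists N => t Nt.
rewrite (_ : (fun eta => _) = (fun eta => \sum_(q <- P) q.1.1 *
    (deviation t (x + q.1.2) i eta - deviation t x i eta))); last first.
  apply/funext => eta; under eq_bigr do rewrite mulrBr.
  rewrite sumrB -mulr_suml (sum_path_weight p_sum1) mul1r; congr (_ - _).
  by rewrite /deviation iterD (iter_avgE _ (fun=> 0)).
apply: (le_trans (absint_sum nu P (fun q => q.1.1) (fun q =>
  measurable_funB (measurable_deviation t (x + q.1.2) i) (measurable_deviation t x i)))).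
apply: (@le_trans _ _ (\sum_(q <- P) (q.1.1 * e)%:E)%E).
  rewrite big_seq [leRHS]big_seq; apply: lee_sum => q qP.
  have q0 := path_weight_ge0 p_ge0 qP.
  by rewrite ger0_norm// EFinM lee_wpmul2l// HN.
by rewrite sumEFin -mulr_suml (sum_path_weight p_sum1) mul1r.
Qed.

Lemma deviation_cauchy i e : 0 < e -> exists N, forall s s', (N <= s)%N -> (N <= s')%N ->
  (absint nu (fun eta => deviation s 0 i eta - deviation s' 0 i eta)%R <= e%:E)%E.
Proof.
move=> e0; have e4 : 0 < e / 4 by rewrite divr_gt0.
have [N HN] := noise_tail_small p_ge0 p_sum1 aper iid centred_coord 0 (0 - e_ i) e4.
exists N => s s' Ns Ns'.
have [M HM] := deviation_step_small s 0 i e4.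
have [M' HM'] := deviation_step_small s' 0 i e4.
pose t := maxn M M'.
have mdev s0 := measurable_deviation s0 0 i.
have mg s0 : measurable_fun setT
    (fun z : conf * S => \sum_(0 <= k < t) noise_grad p 0 (0 - e_ i) s0 k z.2).
  apply: measurable_sum => k.
  exact: (measurableT_comp (measurable_noise_grad _ _ _ _ _) measurable_snd).
have mf s0 : measurable_fun setT (fun z : conf * S => deviation s0 0 i z.1).
  exact: (measurableT_comp (mdev _) measurable_fst).
have mE s0 : measurable_fun setT (fun z => deviation s0 0 i (evolve p t z)).
  exact: (measurableT_comp (mdev _) (measurable_evolve p t)).
rewrite -(preserves_absint (preserves_evolve p_sum1 iid inv t)); last first.
  exact: measurable_funB.
have half s0 : (N <= s0)%N ->
   (absint nu (fun eta => deviation (s0 + t) 0 i eta - deviation t 0 i eta)%R <= (e / 4)%:E)%E ->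
   (absint (nu \x Lam)%E (fun z => deviation s0 0 i (evolve p t z) - deviation t 0 i z.1)%R
     <= (e / 2)%:E)%E.
  move=> Ns0 h.
  apply: (le_trans (absintB _ (mE s0) (mf t) (mf (s0 + t)%N))).
  rewrite (_ : e / 2 = e / 4 + e / 4); last by lra.
  rewrite EFinD leeD//; last first.
    rewrite absintN.
    by rewrite (preserves_absint (preserves_fst nu Lam) (measurable_funB (mdev (s0 + t)%N) (mdev t))).
  rewrite (_ : (fun z => _) = (fun z : conf * S =>
      \sum_(0 <= k < t) noise_grad p 0 (0 - e_ i) s0 k z.2)); last first.
    by apply/funext => z; rewrite deviation_evolve [X in X - _]addrC addrK.
  rewrite (preserves_absint (preserves_snd nu Lam)
    (f := fun s1 => \sum_(0 <= k < t) noise_grad p 0 (0 - e_ i) s0 k s1)).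
    exact: HN.
  by apply: measurable_sum => k; exact: measurable_noise_grad.
apply: (le_trans (absintB _ (mE s) (mE s') (mf t))).
rewrite (splitr e) EFinD leeD// half//.
  by apply: HM; rewrite leq_maxl.
by apply: HM'; rewrite leq_maxr.
Qed.

Lemma deviation_fast_subsequence : exists sigma : nat -> nat,
  (forall n, (n <= sigma n)%N) /\
  forall i n n', (n <= n')%N ->
  (absint nu (fun eta => deviation (sigma n') 0 i eta - deviation (sigma n) 0 i eta)%R
     <= (2^-1 ^+ n)%:E)%E.
Proof.
have /choice[N0 HN0] : forall ni : nat * 'I_d, exists N, forall s s',
    (N <= s)%N -> (N <= s')%N ->
    (absint nu (fun eta => deviation s 0 ni.2 eta - deviation s' 0 ni.2 eta)%R
       <= (2^-1 ^+ ni.1)%:E)%E.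
  by move=> [n i]; apply: deviation_cauchy; rewrite exprn_gt0.
pose sigma n := (n + \sum_(0 <= k < n.+1) \sum_(i < d) N0 (k, i))%N.
have sigma_ge n n' i : (n <= n')%N -> (N0 (n, i) <= sigma n')%N.
  move=> nn'; rewrite /sigma (bigD1_seq n) ?iota_uniq ?mem_index_iota//=.
  by rewrite (bigD1 i)//= addnCA -!addnA leq_addr.
exists sigma; split=> [n|i n n' nn']; first exact: leq_addr.
by apply: (HN0 (n, i)); exact: sigma_ge.
Qed.

Lemma invariant_law_mixture :
  exists2 alpha : conf -> prodR 'I_d R, measurable_fun setT alpha &
  preserves (nu \x Lam)%E nu (fun z j => v j + alpha z.1 j.2 +
    limn (fun n => noise_psum p j.1 (j.1 - e_ j.2) n z.2)).
Proof.
have [sigma [sigma_ge fast]] := deviation_fast_subsequence.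
pose alpha (eta : conf) : prodR 'I_d R :=
  fun i => limn (fun n => deviation (sigma n) 0 i eta).
have malpha1 i : measurable_fun setT (fun eta => alpha eta i).
  by apply: measurable_limn => n; exact: measurable_deviation.
have malpha : measurable_fun setT alpha by exact: measurable_fun_prodR.
exists alpha => //.
have aeconv i : {ae nu, forall eta, cvgn (fun n => deviation (sigma n) 0 i eta)}.
  apply: (@fast_cauchy_cvgn _ _ _ _ (fun n => deviation (sigma n) 0 i)
    (fun n => 2^-1 ^+ n) 2).
  - by move=> n; exact: measurable_deviation.
  - by move=> n; exact: fast.
  - exact: geometric_half_le.
have alpha_lim i n :
    (absint nu (fun eta => alpha eta i - deviation (sigma n) 0 i eta)%R
      <= (2^-1 ^+ n)%:E)%E.
  apply: (absint_lim (f := fun n => deviation (sigma n) 0 i)) => //.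
  - by move=> k; exact: measurable_deviation.
  - by move=> k nk; exact: fast.
pose noise_lim (j : Zd d * 'I_d) (s : S) : R :=
  limn (fun n => noise_psum p j.1 (j.1 - e_ j.2) n s).
have mnl j : measurable_fun setT (noise_lim j).
  by apply: measurable_limn => n; exact: measurable_noise_psum.
apply: (preserves_limit (Y := fun n => evolve p (sigma n))).
- by move=> n; exact: (preserves_evolve p_sum1 iid inv).
- apply: measurable_fun_prodR => j; apply: measurable_funD.
    apply: measurable_funD => //.
    exact: (measurableT_comp (malpha1 _) measurable_fst).
  exact: (measurableT_comp (mnl j) measurable_snd).
move=> [x i] e e0; have e3 : 0 < e / 3 by rewrite divr_gt0.
have [N1 H1] := gradient_decay p_ge0 p_sum1 aper (measurable_dev1 i) (v_growth i) x 0 e3.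
have [N2 H2] : exists N, forall n, (N <= n)%N -> 2^-1 ^+ n <= e / 3.
  have half1 : `|2^-1 : R| < 1 by rewrite ger0_norm; lra.
  have /cvgrPdist_le/(_ _ e3)[N _ HN] := @cvg_expr _ _ half1.
  exists N => n Nn.
  by have := HN n Nn; rewrite sub0r normrN ger0_norm// exprn_ge0.
have [N3 H3] := noise_psum_absint_lim p_ge0 p_sum1 aper iid centred_coord x (x - e_ i) e3.
exists (maxn N1 (maxn N2 N3)) => n; rewrite !geq_max => /and3P[N1n N2n N3n].
have mdx := measurable_deviation (sigma n) x i.
have md0 := measurable_deviation (sigma n) 0 i.
have mps := measurable_noise_psum p centred_coord x (x - e_ i) (sigma n).
pose f1 (eta : conf) : R := deviation (sigma n) x i eta - alpha eta i.
pose f2 (s : S) : R := noise_lim (x, i) s - noise_psum p x (x - e_ i) (sigma n) s.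
have mf1 : measurable_fun setT f1 by exact: measurable_funB.
have mf2 : measurable_fun setT f2 by exact: measurable_funB.
rewrite (_ : (fun t => _) = (fun z : conf * S => f1 z.1 - f2 z.2)); last first.
  apply/funext => z; rewrite /f1 /f2 /evolve/= /deviation iter_avgB iter_harmonic.
  by rewrite -/(noise_lim (x, i) _) /noise_lim/=; ring.
have mF1 : measurable_fun setT (fun z : conf * S => f1 z.1).
  exact: (measurableT_comp mf1 measurable_fst).
have mF2 : measurable_fun setT (fun z : conf * S => f2 z.2).
  exact: (measurableT_comp mf2 measurable_snd).
apply: (le_trans (absintB _ mF1 mF2 (measurable_cst (0 : R)))).
rewrite (_ : e = (e / 3 + e / 3) + e / 3); last by lra.
rewrite EFinD leeD//; last first.
  rewrite (_ : (fun z => _) = (fun z : conf * S => f2 z.2)); last first.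
    by apply/funext => z; rewrite subr0.
  rewrite (preserves_absint (preserves_snd nu Lam) mf2).
  by apply: H3; exact: leq_trans (sigma_ge n).
rewrite (_ : (fun z => _) = (fun z : conf * S => f1 z.1)); last first.
  by apply/funext => z; rewrite subr0.
rewrite (preserves_absint (preserves_fst nu Lam) mf1).
apply: (le_trans (absintB _ mdx (malpha1 i) md0)).
rewrite EFinD leeD//; first by apply: H1; exact: leq_trans (sigma_ge n).
by apply: (le_trans (alpha_lim i n)); rewrite lee_fin H2.
Qed.

End mixture.

(** * The Euclidean norm *)

Section euclidean_norm.
Variables (R : realType) (d : nat).
Implicit Types a b : 'I_d -> R.

Lemma vnorm_ge0 a : 0 <= vnorm a.
Proof. exact: sqrtr_ge0. Qed.

Lemma sqr_vnorm a : vnorm a ^+ 2 = \sum_(i < d) a i ^+ 2.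
Proof. by rewrite sqr_sqrtr// sumr_ge0// => i _; rewrite sqr_ge0. Qed.

Lemma vnorm_cauchy_schwarz a b :
  `|\sum_(i < d) a i * b i| <= vnorm a * vnorm b.
Proof.
rewrite -ler_sqr ?nnegrE ?mulr_ge0 ?vnorm_ge0//.
rewrite real_normK ?num_real// exprMn !sqr_vnorm -subr_ge0.
suff -> : (\sum_(i < d) a i ^+ 2) * (\sum_(i < d) b i ^+ 2) -
    (\sum_(i < d) a i * b i) ^+ 2 =
    2^-1 * \sum_(i < d) \sum_(j < d) (a i * b j - a j * b i) ^+ 2.
  rewrite mulr_ge0// sumr_ge0// => i _; apply: sumr_ge0 => j _; exact: sqr_ge0.
set X := \sum_(i < d) a i ^+ 2; set Y := \sum_(i < d) b i ^+ 2.
set Z := \sum_(i < d) a i * b i.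
rewrite (eq_bigr (fun i => a i ^+ 2 * Y + (b i ^+ 2 * X - 2 * Z * (a i * b i)))).
  by rewrite big_split sumrB/= -!mulr_suml -mulr_sumr -/X -/Y -/Z; field.
move=> i _; rewrite (eq_bigr (fun j => a i ^+ 2 * b j ^+ 2 + (b i ^+ 2 * a j ^+ 2 -
    2 * (a i * b i) * (a j * b j)))).
  by rewrite big_split sumrB/= -!mulr_sumr -/X -/Y -/Z; ring.
by move=> j _; ring.
Qed.

Lemma vnormB a b : vnorm (fun i => a i - b i) <= vnorm a + vnorm b.
Proof.
rewrite -ler_sqr ?nnegrE ?addr_ge0 ?vnorm_ge0// sqr_vnorm sqrrD !sqr_vnorm.
rewrite (eq_bigr (fun i => a i ^+ 2 + (2 * (a i * - b i) + b i ^+ 2))); last first.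
  by move=> i _; ring.
rewrite !big_split/= -mulr_sumr addrA !lerD2r lerD2l -[leRHS]mulr_natl ler_wpM2l//.
rewrite (le_trans (ler_norm _))// (le_trans (vnorm_cauchy_schwarz a (fun i => - b i)))//.
rewrite (_ : vnorm (fun i => - b i) = vnorm b)//.
by congr Num.sqrt; apply: eq_bigr => i _; rewrite sqrrN.
Qed.

Lemma le_vnorm a i : `|a i| <= vnorm a.
Proof.
rewrite -ler_sqr ?nnegrE ?vnorm_ge0// real_normK ?num_real// sqr_vnorm.
by rewrite (bigD1 i)//= lerDl sumr_ge0// => j _; rewrite sqr_ge0.
Qed.

Lemma measurable_vnorm d0 (T : measurableType d0) (f : T -> 'I_d -> R) :
  (forall i, measurable_fun setT (fun t => f t i)) ->
  measurable_fun setT (fun t => vnorm (f t)).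
Proof.
move=> mf; apply: (measurableT_comp
  (continuous_measurable_fun (@sqrt_continuous R))
  (g := fun t => \sum_(i < d) f t i ^+ 2)).
by apply: measurable_sum => i; exact: measurable_funX.
Qed.

Lemma vnorm_mean_le d0 (T : measurableType d0) (mu : probability T R)
    (f : T -> 'I_d -> R) (c : 'I_d -> R) :
  (forall i, mu.-integrable setT (EFin \o f^~ i)) ->
  (forall i, (\int[mu]_t (f t i)%:E = (c i)%:E)%E) ->
  ((vnorm c)%:E <= \int[mu]_t (vnorm (f t))%:E)%E.
Proof.
move=> jf fc.
have mf i : measurable_fun setT (fun t => f t i).
  by apply/measurable_EFinP; case/integrableP: (jf i).
have mv : measurable_fun setT (fun t => (vnorm (f t))%:E).
  by apply/measurable_EFinP; exact: measurable_vnorm.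
have [c0|] := eqVneq (vnorm c) 0.
  by rewrite c0 integral_ge0// => t _; rewrite lee_fin vnorm_ge0.
rewrite neq_lt ltNge vnorm_ge0/= => c0.
rewrite -(@lee_pmul2l _ (vnorm c)%:E)// -ge0_integralZl_EFin//; last 2 first.
- by move=> t _; rewrite lee_fin vnorm_ge0.
- exact: vnorm_ge0.
rewrite -EFinM -expr2 sqr_vnorm.
have jc i : mu.-integrable setT (fun t => (c i)%:E * (f t i)%:E)%E.
  exact: (integrableZl measurableT _ (jf i)).
have jg : mu.-integrable setT (fun t => \sum_(i < d) (c i)%:E * (f t i)%:E)%E.
  exact: integrable_sum.
have -> : ((\sum_(i < d) c i ^+ 2)%:E =
    \int[mu]_t \sum_(i < d) (c i)%:E * (f t i)%:E)%E.
  rewrite integral_sum//.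
  rewrite -sumEFin; apply: eq_bigr => i _.
  by rewrite (integralZl measurableT (jf i)) fc -EFinM expr2.
rewrite (le_trans (lee_abs _))// (le_trans (le_abse_integral _ _ _))//.
  by case/integrableP: jg.
apply: ge0_le_integral => //.
- by apply: measurableT_comp => //; case/integrableP: jg.
- exact: measurable_funeM.
move=> t _; under eq_bigr do rewrite -EFinM.
by rewrite sumEFin -EFinM lee_fin vnorm_cauchy_schwarz.
Qed.

End euclidean_norm.

Section sublinear_deviation.
Variables (R : realType) (d : nat) (nu : probability (conf R d) R).
Hypothesis nu1 : forall x : Zd d,
  (\int[nu]_eta (vnorm (fun i => eta (x, i)))%:E < +oo)%E.
Local Open Scope ereal_scope.

Lemma integrable_coord j : nu.-integrable setT (fun eta : conf R d => (eta j)%:E).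
Proof.
case: j => x i; apply/integrableP; split.
  by apply/measurable_EFinP; exact: measurable_coord.
apply: le_lt_trans (nu1 x); apply: ge0_le_integral => //.
- by apply: measurableT_comp => //; apply/measurable_EFinP; exact: measurable_coord.
- apply/measurable_EFinP; apply: measurable_vnorm => k; exact: measurable_coord.
- by move=> eta _; rewrite lee_fin (le_vnorm (fun i => eta (x, i))).
Qed.

Lemma ubarE x i : \int[nu]_eta (eta (x, i))%:E = (ubar nu x i)%:E.
Proof.
rewrite /ubar fineK//; apply: integrable_fin_num => //; exact: integrable_coord.
Qed.

Lemma measurable_vnormB x (w : 'I_d -> R) :
  measurable_fun setT (fun eta : conf R d => (vnorm (fun i => eta (x, i) - w i)%R)%:E).
Proof.
apply/measurable_EFinP; apply: measurable_vnorm => i.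
by apply: measurable_funB => //; exact: measurable_coord.
Qed.

Lemma ubar_deviation_le (u : Zd d -> 'I_d -> R) x :
  \int[nu]_eta (vnorm (fun i => eta (x, i) - ubar nu x i)%R)%:E <=
  2%:E * \int[nu]_eta (vnorm (fun i => eta (x, i) - u x i)%R)%:E.
Proof.
have h : (vnorm (fun i => ubar nu x i - u x i)%R)%:E <=
    \int[nu]_eta (vnorm (fun i => eta (x, i) - u x i)%R)%:E.
  have ju i : nu.-integrable setT (fun=> (u x i)%:E).
    exact: finite_measure_integrable_cst.
  apply: vnorm_mean_le => i.
    rewrite (_ : _ \o _ = (fun eta => (eta (x, i))%:E - (u x i)%:E)).
      by apply: integrableB => //; exact: integrable_coord.
    by apply/funext => eta /=; rewrite EFinB.
  under eq_integral do rewrite EFinB.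
  rewrite integralB//; last exact: integrable_coord.
  by rewrite ubarE integral_prob_cst EFinB.
rewrite (_ : 2%:E = 1 + 1)// ge0_muleDl// !mul1e.
apply: (le_trans _ (leeD (lexx _) h)).
rewrite -(integral_prob_cst nu (vnorm _)%:E) -ge0_integralD//; last 3 first.
- by move=> eta _; rewrite lee_fin vnorm_ge0.
- exact: measurable_vnormB.
- by move=> eta _; rewrite lee_fin vnorm_ge0.
apply: ge0_le_integral => //.
- by move=> eta _; rewrite lee_fin vnorm_ge0.
- exact: measurable_vnormB.
- by apply: emeasurable_funD => //; exact: measurable_vnormB.
move=> eta _; rewrite -EFinD lee_fin.
rewrite (_ : (fun i => eta (x, i) - ubar nu x i)%R =
  (fun i => (eta (x, i) - u x i) - (ubar nu x i - u x i))%R); first exact: vnormB.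
by apply/funext => i; ring.
Qed.

Let dev (u : Zd d -> 'I_d -> R) (r : R) : set (\bar R) :=
  [set \int[nu]_eta (vnorm (fun i => eta (x, i) - u x i)%R)%:E
     | x in [set x : Zd d | (znorm R x <= r)%R]].

Let znorm0 : znorm R (0%R : Zd d) = 0%R.
Proof.
by rewrite /znorm big1 ?sqrtr0// => i _; rewrite mxE expr0n.
Qed.

Let dev_sup_ge0 u (r : R) : (0 <= r)%R -> 0 <= ereal_sup (dev u r).
Proof.
move=> r0; apply: (@le_trans _ _
    (\int[nu]_eta (vnorm (fun i => eta ((0 : Zd d), i) - u (0 : Zd d) i)%R)%:E)).
  by apply: integral_ge0 => eta _; rewrite lee_fin vnorm_ge0.
by apply: ereal_sup_ubound; exists 0%R => //=; rewrite znorm0.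
Qed.

Lemma sublinear_dev_ubar (u : Zd d -> 'I_d -> R) :
  sublinear_dev nu u -> sublinear_dev nu (ubar nu).
Proof.
rewrite /sublinear_dev => hu.
have h2 : (2%:E * ((Num.sqrt r)^-1%:E * ereal_sup (dev u r))) @[r --> +oo%R] --> 2%:E * 0.
  exact: cvgeZl.
rewrite mule0 in h2.
apply: (squeeze_cvge _ (cvg_cst 0) h2).
exists 0%R; split => // r r0.
have s0 : 0 <= ((Num.sqrt r)^-1)%:E by rewrite lee_fin invr_ge0 sqrtr_ge0.
apply/andP; split; first by rewrite mule_ge0// dev_sup_ge0// ltW.
rewrite muleCA lee_wpmul2l//; apply: ge_ereal_sup => _ [x /= xr <-].
apply: (le_trans (ubar_deviation_le u x)).
rewrite lee_wpmul2l//; apply: ereal_sup_ubound.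
by exists x.
Qed.

Lemma sublinear_dev_subdiffusive (u : Zd d -> 'I_d -> R) i : sublinear_dev nu u ->
  subdiffusive nu (fun x (eta : conf R d) => eta (x, i) - u x i)%R.
Proof.
move=> hu eps eps0.
have /fine_cvgP[hfin hcv] : ((Num.sqrt r)^-1%:E * ereal_sup (dev u r)) @[r --> +oo%R] --> 0%R%:E.
  exact: hu.
have hlt := cvgr_lt _ hcv _ eps0.
have [r0 [_ Hr0]] : \forall r \near +oo%R, (Num.sqrt r)^-1%:E * ereal_sup (dev u r) <= eps%:E.
  near=> r.
  have ffin : (Num.sqrt r)^-1%:E * ereal_sup (dev u r) \is a fin_num by near: r.
  rewrite -(fineK ffin) lee_fin; apply: ltW; near: r; exact: hlt.
exists (Num.max 1 (r0 + 1))%R => r x; rewrite ge_max => /andP[r1 rr0] xr.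
have r_gt0 : (0 < r)%R by rewrite (lt_le_trans _ r1).
have sr : (0 < Num.sqrt r)%R by rewrite sqrtr_gt0.
have := Hr0 r; rewrite (lt_le_trans _ rr0) ?ltrDl// => /(_ isT).
rewrite lee_pdivrMl// -EFinM mulrC => h; apply: le_trans h.
apply: (@le_trans _ _ (\int[nu]_eta (vnorm (fun i => eta (x, i) - u x i)%R)%:E)).
  apply: ge0_le_integral => //.
  - apply/measurable_EFinP; apply: measurableT_comp => //.
    by apply: measurable_funB => //; exact: measurable_coord.
  - exact: measurable_vnormB.
  by move=> eta _; rewrite lee_fin (le_vnorm (fun i => eta (x, i) - u x i)%R).
by apply: ereal_sup_ubound; exists x.
Unshelve. all: by end_near. Qed.

End sublinear_deviation.

(** * The law of the noise *)

Section canonical_noise.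
Variables (R : realType) (d : nat) (p : Zd d -> R).
Context (dO : measure_display) (Omega : measurableType dO).
Variables (P : probability Omega R) (xi : int -> Zd d -> Omega -> R).
Hypothesis hxi : iid_noise P xi.
Local Notation S := (prodR (nat * Zd d)%type R).

Definition marginal (B : set R) : \bar R := P (xi 0 0 @^-1` B).

Lemma iid_field_noise :
  iid_field marginal P (fun w (j : int * Zd d) => xi j.1 j.2 w).
Proof.
case: hxi => mxi prodxi idxi _ _; split.
  by apply: measurable_fun_prodR => j; exact: mxi.
move=> s B us mB; rewrite [LHS]prodxi//; apply: eq_bigr => j _.
exact: (idxi j (0, 0)).
Qed.

Definition past_noise (w : Omega) : S := fun j => xi (- (j.1%:Z)) j.2 w.

Lemma iid_field_past : iid_field marginal P past_noise.
Proof.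
apply: (iid_field_reindex (phi := fun j : nat * Zd d => (- (j.1%:Z), j.2)) _ iid_field_noise).
by move=> [k z] [l z'] [/oppr_inj [->] ->].
Qed.

Definition noise_law : probability S R := law P iid_field_past.1.

Lemma iid_field_noise_law : iid_field marginal noise_law id.
Proof.
split; first exact: measurable_id.
by move=> s B us mB; rewrite -(iid_field_past.2 s B us mB).
Qed.

Lemma centred_noise_law j : centred noise_law (fun s : S => s j).
Proof.
case: hxi => mxi _ _ meanxi varxi.
have mj : measurable_fun setT (fun s : S => s j) := @measurable_coord _ R j.
have mEj : measurable_fun setT (fun s : S => (s j)%:E) by exact/measurable_EFinP.
have [ji mi] := meanxi (- (j.1%:Z)) j.2.
split=> //.
- exact: (integrable_law iid_field_past.1 mEj).
- by rewrite /noise_law (integral_law iid_field_past.1 mEj).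
- rewrite /sqint /noise_law (ge0_integral_law P iid_field_past.1 (f := fun s => (s j ^+ 2)%:E)).
  + exact: varxi.
  + by apply/measurable_EFinP; exact: measurable_funX.
  + by move=> s; rewrite lee_fin sqr_ge0.
Qed.

Lemma noise_lawE A : noise_law A = P (past_noise @^-1` A).
Proof. by []. Qed.

Hypothesis p_sum1 : \sum_(x \in [set: Zd d]) p x = 1.

Lemma Delta0E j w : Delta0 p xi j w =
  limn (fun n => noise_psum p j.1 (j.1 - e_ j.2) n (past_noise w)).
Proof.
apply: (congr1 (fun u : R^nat => limn u)); apply/funext => n; apply: eq_bigr => k _.
by rewrite (fsum_pkB p_sum1 k (fun z => xi (- (k%:Z)) z w)).
Qed.

Variable nu : probability (conf R d) R.
Hypothesis hnu : chain_invariant p P xi nu.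

Lemma chain_invariant_noise_law l E : measurable E ->
  (\int[nu]_eta noise_law ((fun s : S => step p eta (fun x => s (l, x))) @^-1` E)
    = nu E)%E.
Proof.
move=> mE; rewrite -(hnu mE); apply: eq_integral => eta _.
have i1 : iid_field marginal P (fun w => (fun x => xi 1 x w) : prodR (Zd d) R).
  apply: (iid_field_reindex (phi := fun x : Zd d => ((1 : int), x)) _ iid_field_noise).
  by move=> x y [].
have i2 : iid_field marginal noise_law (fun s => (fun x => s (l, x)) : prodR (Zd d) R).
  apply: (iid_field_reindex (phi := fun x : Zd d => (l, x)) _ iid_field_noise_law).
  by move=> x y [].
have ms : measurable_fun setT (fun f : prodR (Zd d) R => step p eta f).
  apply: measurable_fun_prodR => j; under eq_fun do rewrite (stepE p_sum1).
  apply: measurable_funB; last exact: measurable_coord.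
  by apply: measurable_funD => //; exact: measurable_coord.
have mA : measurable ((fun f : prodR (Zd d) R => step p eta f) @^-1` E).
  by rewrite -[X in measurable X]setTI; exact: ms.
exact: (iid_field_eq_law i2 i1 mA).
Qed.

End canonical_noise.

Lemma ubar_harmonic (R : realType) (d : nat) (p : Zd d -> R)
    (Lam : probability (prodR (nat * Zd d) R) R) (nu : probability (conf R d) R) :
  \sum_(x \in [set: Zd d]) p x = 1 ->
  (forall j, centred Lam (fun s => s j)) ->
  (forall l E, measurable E -> (\int[nu]_eta
     Lam ((fun s => step p eta (fun x => s (l, x))) @^-1` E) = nu E)%E) ->
  (forall x : Zd d, (\int[nu]_eta (vnorm (fun i => eta (x, i)))%:E < +oo)%E) ->
  forall x i, avg p (fun z => ubar nu z i) x = ubar nu x i.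
Proof.
move=> p_sum1 cLam inv nu1 x i.
have pstep := preserves_step p_sum1 inv 0.
have jc z := integrable_coord nu1 (z, i).
apply: EFin_inj; rewrite -(ubarE nu1) -(preserves_integral pstep (jc x)).
have jfst z := preserves_integrable (preserves_fst nu Lam) (jc z).
have js z : (nu \x Lam)%E.-integrable setT (fun t => (t.2 (0%N, z))%:E).
  apply: (preserves_integrable (preserves_snd nu Lam) (f := fun s => (s (0%N, z))%:E)).
  by have [] := cLam (0%N, z).
have is0 z : (\int[(nu \x Lam)%E]_t (t.2 (0%N, z))%:E = 0)%E.
  rewrite (preserves_integral (preserves_snd nu Lam) (f := fun s => (s (0%N, z))%:E)).
    by have [] := cLam (0%N, z).
  by have [] := cLam (0%N, z).
pose F (t : conf R d * prodR (nat * Zd d) R) :=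
  (\sum_(y <- supp p) (p y)%:E * (t.1 ((x + y)%R, i))%:E)%E.
have jF1 y : (nu \x Lam)%E.-integrable setT
    (fun t => ((p y)%:E * (t.1 ((x + y)%R, i))%:E)%E).
  exact: (integrableZl measurableT _ (jfst (x + y))).
have jF : (nu \x Lam)%E.-integrable setT F by exact: integrable_sum.
rewrite (eq_integral (fun t => (F t + (t.2 (0%N, x))%:E) -
    (t.2 (0%N, (x - e_ i)%R))%:E)%E); last first.
  move=> t _; rewrite (stepE p_sum1) EFinB EFinD /F /= /avg -sumEFin.
  by congr (_ + _ + _)%E; apply: eq_bigr => y _; rewrite EFinM.
rewrite integralB//; last exact: integrableD.
rewrite integralD// !is0 adde0 sube0 /F integral_sum//.
rewrite /avg -sumEFin; apply: eq_bigr => y _.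
rewrite (integralZl measurableT (jfst (x + y))).
by rewrite (preserves_integral (preserves_fst nu Lam) (jc (x + y))) (ubarE nu1) EFinM.
Qed.

Theorem theorem2p4 (R : realType) (d : nat) (p : Zd d -> R)
    (dO : measure_display) (Omega : measurableType dO) (P : probability Omega R)
    (xi : int -> Zd d -> Omega -> R) (nu : probability (conf R d) R) :
  is_kernel p -> iid_noise P xi -> chain_invariant p P xi nu ->
  (forall x : Zd d, (\int[nu]_eta (vnorm (fun i => eta (x, i)))%:E < +oo)%E) ->
  (exists u : Zd d -> 'I_d -> R, p_harmonic p u /\ sublinear_dev nu u) ->
  sublinear_dev nu (ubar nu) /\
  exists gamma : probability (prodR 'I_d R) R,
    forall A : set (conf R d), measurable A ->
      nu A = (\int[gamma]_alpha
                pi_ p P xi (fun xi_ => (ubar nu xi_.1 xi_.2 + alpha xi_.2)%R) A)%E.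
Proof.
move=> [p01 p_sum1 _ aper] hxi hnu nu1 [u [_ hu]].
have p_ge0 x : 0 <= p x by have [] := p01 x.
have hubar := sublinear_dev_ubar nu1 hu; split=> //.
have iid := iid_field_noise_law hxi.
have cLam := centred_noise_law hxi.
have inv := chain_invariant_noise_law hxi p_sum1 hnu.
have [alpha malpha pPsi] := invariant_law_mixture p_ge0 p_sum1 aper iid cLam inv
  (v := fun j => ubar nu j.1 j.2) (ubar_harmonic p_sum1 cLam inv nu1)
  (fun i => sublinear_dev_subdiffusive i hubar).
exists (law nu malpha) => A mA.
pose Phi (z : prodR 'I_d R * prodR (nat * Zd d) R) : conf R d := fun j =>
  ubar nu j.1 j.2 + z.1 j.2 + limn (fun n => noise_psum p j.1 (j.1 - e_ j.2) n z.2).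
have mPhi : measurable_fun setT Phi.
  apply: measurable_fun_prodR => j; apply: measurable_funD.
    apply: measurable_funD => //.
    exact: (measurableT_comp (measurable_coord _) measurable_fst).
  apply: (measurableT_comp (f := fun s => limn (fun n =>
    noise_psum p j.1 (j.1 - e_ j.2) n s)) _ measurable_snd).
  apply: measurable_limn => n; exact: (measurable_noise_psum p cLam).
have mPA : measurable (Phi @^-1` A).
  by rewrite -[X in measurable X]setTI; exact: mPhi.
have piE a : pi_ p P xi (fun xi_ => (ubar nu xi_.1 xi_.2 + a xi_.2)%R) A =
    noise_law hxi (xsection (Phi @^-1` A) a).
  rewrite noise_lawE /pi_; congr (P _); apply/funext => w.
  rewrite /preimage /xsection/= in_setE; congr A; apply/funext => j.
  by rewrite (Delta0E xi p_sum1).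
under eq_integral do rewrite piE.
rewrite ge0_integral_law//; last exact: measurable_fun_xsection.
rewrite -(pPsi.2 A mA); apply: eq_integral => eta _ /=.
by congr (noise_law _ _); apply/seteqP; split => s; rewrite /xsection/= !inE.
Qed.
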